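(* Let $M\ge1$ and let $X$ be a $\mathcal{C}=(0,\ldots,0\,;q)$ cookie random walk, with $M$ cookies of strength $0$ and $q\in(0,1)$. Define $$\lambda_{\mathrm{dig}}=\left(\frac{q}{b(1-q)}\right)^{M+1}.$$ Then $X$ is recurrent if and only if $\lambda_{\mathrm{dig}}\le 1/b$.
   Context: Fix an integer $b\ge2$. $\mathbb{T}$ is the infinite rooted $b$-ary tree with root $o$; each vertex $x$ has $b$ sons, each $x\ne o$ has a father, and by convention the father of $o$ is $o$ itself. A cookie environment is a vector $\mathcal{C}=(p_1,\ldots,p_M\,;q)\in[0,1)^M\times(0,1)$ with $M\ge1$. A $\mathcal{C}$ cookie random walk is a process $X=(X_n)_{n\ge0}$ on $\mathbb{T}$ with $X_0=o$ such that, conditionally on $X_0,\ldots,X_n$, with $j=\#\{0\le k\le n: X_k=X_n\}$, $X_{n+1}$ is each given son of $X_n$ with probability $p_j/b$ if $j\le M$ and $q/b$ if $j>M$, and is the father of $X_n$ with probability $1-p_j$ if $j\le M$ and $1-q$ if $j>M$. The walk is recurrent if it visits every vertex of $\mathbb{T}$ infinitely often with probability $1$. *)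

(* Defs.v *)
From HB Require Import structures.
From mathcomp Require Import all_boot all_order all_algebra.
From mathcomp Require Import all_classical all_reals all_analysis.

Set Implicit Arguments.
Unset Strict Implicit.
Unset Printing Implicit Defensive.

Import Order.TTheory GRing.Theory Num.Theory.

Local Open Scope classical_set_scope.
Local Open Scope ring_scope.

(* A vertex of the rooted b-ary tree is the word of the choices leading to it
   from the root, most recent choice first. *)
Definition vertex (b : nat) := seq 'I_b.

Definition root (b : nat) : vertex b := [::].

Definition son (b : nat) (x : vertex b) (i : 'I_b) : vertex b := i :: x.

(* [behead [::] = [::]]: the root is its own father. *)
Definition father (b : nat) (x : vertex b) : vertex b := behead x.

(* Strength of the cookie met at the [j]-th visit, [j >= 1]: it is [p_j] if
   [j <= M] and [q] otherwise. The tuple is indexed from 0. *)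
Definition strength (R : realType) (M : nat) (p : M.-tuple R) (q : R)
  (j : nat) : R := nth q p j.-1.

Section walk.
Context {d : measure_display} {T : measurableType d} {R : realType}.
Variable P : probability T R.

Definition cond_prob (A B : set T) : R := fine (P (A `&` B)) / fine (P B).

Variable b : nat.

Definition history (X : nat -> T -> vertex b) (n : nat) (h : nat -> vertex b) :
  set T := [set w | forall k, (k <= n)%N -> X k w = h k].

Definition nvisits (h : nat -> vertex b) (n : nat) : nat :=
  #|[pred k : 'I_n.+1 | h k == h n]|.

(* The vertices form a countable set, so conditioning on [X_0, ..., X_n] is
   elementary conditioning on each history of positive probability. *)
Definition cookie_walk (M : nat) (p : M.-tuple R) (q : R)
    (X : nat -> T -> vertex b) : Prop :=
  [/\ forall n (A : set (vertex b)), measurable (X n @^-1` A),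
      P [set w | X 0%N w = root b] = 1%E &
      forall n h, (0 < P (history X n h))%E ->
        let s := strength p q (nvisits h n) in
        (forall i : 'I_b,
          cond_prob [set w | X n.+1 w = son (h n) i] (history X n h)
            = s / b%:R) /\
        cond_prob [set w | X n.+1 w = father (h n)] (history X n h) = 1 - s].

Definition recurrent (X : nat -> T -> vertex b) : Prop :=
  P [set w | forall x : vertex b, infinite_set [set n | X n w = x]] = 1%E.

End walk.

Definition lambda_dig (R : realType) (b M : nat) (q : R) : R :=
  (q / (b%:R * (1 - q))) ^+ M.+1.

(* Main.v *)
Require Import Defs.
From mathcomp Require Import all_boot all_order all_algebra.
From mathcomp Require Import all_classical all_reals all_analysis.
From mathcomp Require Import ring lra zify.
Set Implicit Arguments.
Unset Strict Implicit.
Unset Printing Implicit Defensive.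
Import Order.TTheory GRing.Theory Num.Theory.
Import numFieldNormedType.Exports.
Local Open Scope classical_set_scope.
Local Open Scope ring_scope.

(** The moves made at a vertex may be thought of as read from a stack attached to
    that vertex. Watch the walk until it has made [K] steps from the root to
    itself, called bounces. If all these steps occur, each vertex has returned to its
    father exactly as often as it has been entered. Given that a vertex makes [k]
    returns, its first [M] visits are returns forced by the cookies, and each of
    the remaining [k - M] returns is preceded by a geometric number of jumps to the
    sons. The numbers of jumps along the edges thus form a branching process
    whose types are integers ([extinct]), and the [K]-th bounce at the root fails
    to occur exactly when this process survives.

    Let [m = q / (b (1 - q))] be the odds of a jump to a given son against a return.
    The number of jumps to that son is a sum of [k - M] independent geometric
    variables, and its binomial moment of order [M.+1] is
    ['C(k, M.+1) * m ^+ M.+1] ([moment_at0]). So [g k = 'C(k, M.+1)] is an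
    eigenfunction of the mean offspring operator, with eigenvalue
    [b * m ^+ M.+1] when all the [b] sons are counted, and the criterion says that
    this eigenvalue is at most 1.

    If it is at most 1, the survival probability is bounded by multiples
    of [g] and by 1, and the cap at 1 makes the iteration strictly contracting as
    long as the bound is not small, which also covers the critical case
    ([extinct_to1]). If it exceeds 1, a bounded function multiplied by more
    than 1 by the mean offspring operator, once scaled down, is a lower bound for
    the survival probability ([extinct_le]); such functions are a geometrically
    damped version of [g] when [m <= 1], and [1 - y ^+ (k - A)] cut at 0 when
    [1 < m] ([extinct_lt1]).

    The branching process is related to the walk without constructing the stacks.
    The conditional probability of extinction before depth [L] given a history
    is an explicit function [cond_extinct] of the numbers of moves made so far,
    and it is a martingale along the walk ([cond_extinct_step], [walk_step]). It
    equals 1 if the [K]-th bounce comes before depth [L] is reached, and 0 once depth [L]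
    is reached, whence the two bounds [completed_bound] and
    [reached_bound]; [confined_bound] excludes that neither happens. All
    these estimates are instances of one supermartingale inequality
    ([supermartingale_bound]), which only uses the elementary conditional
    probabilities of the walk. The same inequality yields that infinitely many
    visits to a vertex entail infinitely many moves of each kind from it
    ([visits_le_moves]); hence infinitely many bounces are equivalent to
    infinitely many visits to the root, and these propagate to all vertices. *)

(** * Numbers of jumps to the sons before r returns to the father *)
Section geometric.
Context {R : realType} (b : nat) (q : R).
Context (b_gt0 : (0 < b)%N) (q_gt0 : 0 < q) (q_lt1 : q < 1).

(** How many times each of the [b] sons of a vertex has been entered. *)
Definition profile := {ffun 'I_b -> nat}.

Implicit Types (l : profile) (phi psi : profile -> R).

Definition incr l (i : 'I_b) : profile := [ffun j => (l j + (j == i))%N].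

Definition up_closed (D : set profile) := forall l i, D l -> D (incr l i).

Definition bounded_nonneg phi := exists C, forall l, 0 <= phi l <= C.

(** Once the cookies are eaten, a visit to a vertex ends the current count with
    probability [1 - q], and otherwise adds one jump to a uniform son. This is
    the resulting one-step equation: [phi] is collected when the count ends,
    [psi] after one more jump. *)
Definition geom_step phi psi l : R :=
  (1 - q) * phi l + q / b%:R * \sum_i psi (incr l i).

Fixpoint geom_trunc n phi l : R :=
  if n is n'.+1 then geom_step phi (geom_trunc n' phi) l else 0.

(** The expectation of [phi (l + N)], where [N] counts the jumps to the sons made
    before one return to the father. It is built as the smallest nonnegative
    solution of [psi = geom_step phi psi], reached from below by the
    expectations restricted to counts that stop within [n] visits; no
    probability space is needed. *)
Definition geom phi l : R := limn (fun n => geom_trunc n phi l).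

(** Expectation of [phi (l + N)] with [N] counting the jumps before [r] returns: the
    increments between successive returns are independent, so the operators
    compose. *)
Definition nbinom r phi : profile -> R := iter r geom phi.

Lemma b_neq0 : (b%:R : R) != 0.
Proof. by rewrite pnatr_eq0 -lt0n. Qed.

Lemma qb_gt0 : 0 < q / b%:R.
Proof. by rewrite divr_gt0 // ltr0n. Qed.

Lemma geom_step_const C D : geom_step (fun=> C) (fun=> D) = fun=> (1 - q) * C + q * D.
Proof.
apply/funext => l; rewrite /geom_step sumr_const card_ord -[D *+ b]mulr_natl.
by rewrite mulrA divfK // b_neq0.
Qed.

Lemma geom_step_le (D : set profile) phi phi' psi psi' : up_closed D ->
    (forall l, D l -> phi l <= phi' l) -> (forall l, D l -> psi l <= psi' l) ->
  forall l, D l -> geom_step phi psi l <= geom_step phi' psi' l.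
Proof.
move=> Dup le1 le2 l Dl; apply: lerD.
  by rewrite ler_wpM2l ?le1 // subr_ge0 ltW.
by rewrite ler_wpM2l ?(ltW qb_gt0) //; apply: ler_sum => i _; exact/le2/Dup.
Qed.

Lemma geom_trunc_bound phi C : (forall l, 0 <= phi l <= C) ->
  forall n l, 0 <= geom_trunc n phi l <= C.
Proof.
move=> h; have C0 : 0 <= C by have /andP[] := h [ffun=> 0%N]; exact: le_trans.
elim=> [|n IH] l /=; first by rewrite lexx.
have hT : up_closed setT by [].
have le0 := geom_step_le (l := l) hT (fun l' _ => proj1 (andP (h l')))
  (fun l' _ => proj1 (andP (IH l'))) I.
have leC := geom_step_le (l := l) hT (fun l' _ => proj2 (andP (h l')))
  (fun l' _ => proj2 (andP (IH l'))) I.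
rewrite !geom_step_const !mulr0 addr0 -mulrDl subrK mul1r in le0 leC.
by rewrite le0 leC.
Qed.

Lemma geom_trunc_nd phi l : bounded_nonneg phi ->
  nondecreasing_seq (fun n => geom_trunc n phi l).
Proof.
move=> [C h]; apply/nondecreasing_seqP => n; elim: n l => [|n IH] l.
  by have /andP[] := geom_trunc_bound h 1 l.
apply: (@geom_step_le setT) => //; by move=> *; exact: IH.
Qed.

Lemma geom_trunc_cvg phi l : bounded_nonneg phi ->
  geom_trunc n phi l @[n --> \oo] --> geom phi l.
Proof.
move=> bphi; apply: nondecreasing_is_cvgn; first exact: geom_trunc_nd.
case: bphi => C h; exists C => _ [n _ <-].
by have /andP[] := geom_trunc_bound h n l.
Qed.

Lemma geom_bound phi C : (forall l, 0 <= phi l <= C) ->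
  forall l, 0 <= geom phi l <= C.
Proof.
move=> h l; have bphi : bounded_nonneg phi by exists C.
have cv := geom_trunc_cvg (l := l) bphi.
apply/andP; split.
  apply: (limr_ge _); first by apply/cvg_ex; eexists; exact: cv.
  by near=> n; have /andP[] := geom_trunc_bound h n l.
apply: (limr_le _); first by apply/cvg_ex; eexists; exact: cv.
by near=> n; have /andP[] := geom_trunc_bound h n l.
Unshelve. all: by end_near. Qed.

Lemma geom_fix phi l : bounded_nonneg phi ->
  geom phi l = geom_step phi (geom phi) l.
Proof.
move=> bphi.
have c1 := geom_trunc_cvg (l := l) bphi; rewrite -cvg_shiftS in c1.
have c2 : geom_step phi (geom_trunc n phi) l @[n --> \oo] -->
    geom_step phi (geom phi) l.
  apply: cvgD; first exact: cvg_cst.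
  apply: cvgMr; apply: cvg_big => [|i _]; first exact: add_continuous.
  exact: geom_trunc_cvg.
exact: (cvg_unique _ c1 c2).
Qed.

(** Every nonnegative supersolution dominates each truncation, by induction on the
    number of visits. The set [D] allows [phi] and [psi] to be compared only on
    the profiles that can still be reached. *)
Lemma geom_le_super (D : set profile) phi psi : up_closed D ->
    bounded_nonneg phi -> (forall l, D l -> 0 <= psi l) ->
    (forall l, D l -> geom_step phi psi l <= psi l) ->
  forall l, D l -> geom phi l <= psi l.
Proof.
move=> Dup bphi psi0 sup l Dl.
have h n : forall l, D l -> geom_trunc n phi l <= psi l.
  elim: n => [|n IH] l' Dl' /=; first exact: psi0.
  by apply: le_trans (sup _ Dl'); exact: (geom_step_le Dup).
apply: (limr_le _); last by near=> n; exact: h.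
by apply/cvg_ex; eexists; exact: geom_trunc_cvg.
Unshelve. all: by end_near. Qed.

(** A subsolution that is bounded above is dominated: after [n] visits the
    defect is at most [q ^+ n * C]. Some bound is indispensable, because the
    equation has unbounded solutions besides [geom phi]. *)
Lemma geom_ge_sub (D : set profile) phi psi C : up_closed D ->
    bounded_nonneg phi -> (forall l, D l -> psi l <= C) ->
    (forall l, D l -> psi l <= geom_step phi psi l) ->
  forall l, D l -> psi l <= geom phi l.
Proof.
move=> Dup bphi psiC sub l Dl.
have h n : forall l, D l -> psi l <= geom_trunc n phi l + q ^+ n * C.
  elim: n => [|n IH] l' Dl' /=; first by rewrite expr0 mul1r add0r psiC.
  apply: (le_trans (sub _ Dl')).
  have -> : geom_step phi (geom_trunc n phi) l' + q ^+ n.+1 * C =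
    geom_step phi (fun l => geom_trunc n phi l + q ^+ n * C) l'.
    rewrite /geom_step big_split /= mulrDr addrA sumr_const card_ord.
    congr (_ + _); rewrite -[(_ * C) *+ b]mulr_natl exprS.
    by field; exact: b_neq0.
  exact: (geom_step_le Dup).
have cv : (geom_trunc n phi l + q ^+ n * C) @[n --> \oo] --> geom phi l.
  rewrite -[X in _ --> X]addr0 -[X in _ + X](mul0r C).
  apply: cvgD; first exact: geom_trunc_cvg.
  by apply: cvgMl; apply: cvg_expr; rewrite ger0_norm // ltW.
rewrite -(cvg_lim (@Rhausdorff R) cv); apply: limr_ge.
  by apply/cvg_ex; eexists; exact: cv.
by near=> n; exact: h.
Unshelve. all: by end_near. Qed.

(** Closed forms for negative binomial expectations are obtained from here: it is
    enough to check the one-step equation and boundedness. *)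
Lemma geom_unique phi psi : bounded_nonneg phi -> bounded_nonneg psi ->
  (forall l, psi l = geom_step phi psi l) -> geom phi = psi.
Proof.
move=> bphi [C hpsi] eq; apply/funext => l; apply/le_anti/andP; split.
  apply: (@geom_le_super setT) => // l' _; last by rewrite -eq.
  by have /andP[] := hpsi l'.
apply: (@geom_ge_sub setT _ _ C) => // l' _; last by rewrite -eq.
by have /andP[] := hpsi l'.
Qed.

Lemma bounded_geom phi : bounded_nonneg phi -> bounded_nonneg (geom phi).
Proof. by move=> [C h]; exists C; exact: geom_bound. Qed.

Lemma boundedD phi psi : bounded_nonneg phi -> bounded_nonneg psi ->
  bounded_nonneg (fun l => phi l + psi l).
Proof.
move=> [C h] [C' h']; exists (C + C') => l.
by have /andP[? ?] := h l; have /andP[? ?] := h' l; rewrite addr_ge0 //= lerD.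
Qed.

Lemma boundedZ c phi : 0 <= c -> bounded_nonneg phi ->
  bounded_nonneg (fun l => c * phi l).
Proof.
move=> c0 [C h]; exists (c * C) => l.
by have /andP[? ?] := h l; rewrite mulr_ge0 //= ler_wpM2l.
Qed.

Lemma bounded_const c : 0 <= c -> bounded_nonneg (fun=> c).
Proof. by exists c => l; rewrite lexx andbT. Qed.

Lemma bounded_sum (I : Type) (r : seq I) (F : I -> profile -> R) :
  (forall i, bounded_nonneg (F i)) ->
  bounded_nonneg (fun l => \sum_(i <- r) F i l).
Proof.
move=> h; elim: r => [|i r IH].
  by exists 0 => l; rewrite big_nil lexx.
have [C hC] := boundedD (h i) IH; exists C => l.
by rewrite big_cons.
Qed.

Lemma geomD phi psi : bounded_nonneg phi -> bounded_nonneg psi ->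
  geom (fun l => phi l + psi l) = fun l => geom phi l + geom psi l.
Proof.
move=> h h'; apply: geom_unique; [exact: boundedD| |move=> l].
  by apply: boundedD; exact: bounded_geom.
rewrite [in LHS]geom_fix // [in LHS](geom_fix (phi := psi)) // /geom_step.
by rewrite big_split /=; ring.
Qed.

Lemma geomZ c phi : 0 <= c -> bounded_nonneg phi ->
  geom (fun l => c * phi l) = fun l => c * geom phi l.
Proof.
move=> c0 h; apply: geom_unique; [exact: boundedZ| |move=> l].
  by apply: boundedZ; [|exact: bounded_geom].
rewrite [in LHS]geom_fix // /geom_step -mulr_sumr; ring.
Qed.

Lemma geom_const c : 0 <= c -> geom (fun=> c) = fun=> c.
Proof.
move=> c0; apply: geom_unique; try exact: bounded_const.
by move=> l; rewrite geom_step_const; ring.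
Qed.

Lemma bounded_nbinom r phi : bounded_nonneg phi -> bounded_nonneg (nbinom r phi).
Proof. by move=> h; elim: r => // r IH; exact: bounded_geom. Qed.

Lemma nbinom_bound r phi C : (forall l, 0 <= phi l <= C) ->
  forall l, 0 <= nbinom r phi l <= C.
Proof. by move=> h; elim: r => // r IH; exact: geom_bound. Qed.

Lemma nbinomS r phi l : bounded_nonneg phi ->
  nbinom r.+1 phi l = geom_step (nbinom r phi) (nbinom r.+1 phi) l.
Proof. by move=> h; rewrite [LHS]geom_fix //; exact: bounded_nbinom. Qed.

Lemma nbinomD r phi psi : bounded_nonneg phi -> bounded_nonneg psi ->
  nbinom r (fun l => phi l + psi l) = fun l => nbinom r phi l + nbinom r psi l.
Proof.
move=> h h'; elim: r => [//|r IH].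
rewrite /nbinom iterS -/(nbinom r _) IH geomD //; exact: bounded_nbinom.
Qed.

Lemma nbinomZ r c phi : 0 <= c -> bounded_nonneg phi ->
  nbinom r (fun l => c * phi l) = fun l => c * nbinom r phi l.
Proof.
move=> c0 h; elim: r => [//|r IH].
rewrite /nbinom iterS -/(nbinom r _) IH geomZ //; exact: bounded_nbinom.
Qed.

Lemma nbinom_const r c : 0 <= c -> nbinom r (fun=> c) = fun=> c.
Proof.
move=> c0; elim: r => // r IH.
by rewrite /nbinom iterS -/(nbinom r _) IH geom_const.
Qed.

Lemma nbinom_sum r (I : Type) (s : seq I) (F : I -> profile -> R) :
  (forall i, bounded_nonneg (F i)) ->
  nbinom r (fun l => \sum_(i <- s) F i l) = fun l => \sum_(i <- s) nbinom r (F i) l.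
Proof.
move=> h; elim: s => [|i s IH].
  under eq_fun do rewrite big_nil.
  by rewrite nbinom_const //; apply/funext => l; rewrite big_nil.
under eq_fun do rewrite big_cons.
rewrite nbinomD ?IH //; last exact: bounded_sum.
by apply/funext => l; rewrite big_cons.
Qed.

Lemma nbinom_le_super (D : set profile) phi (psi : nat -> profile -> R) :
    up_closed D -> bounded_nonneg phi ->
    (forall r l, D l -> 0 <= psi r l) -> (forall l, D l -> phi l <= psi 0%N l) ->
    (forall r l, D l -> geom_step (psi r) (psi r.+1) l <= psi r.+1 l) ->
  forall r l, D l -> nbinom r phi l <= psi r l.
Proof.
move=> Dup bphi psi0 base sup; elim=> [//|r IH] l Dl.
apply: (@geom_le_super D) => //; [exact: bounded_nbinom|exact: psi0|].
move=> l' Dl'; apply: le_trans (sup _ _ Dl').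
exact: (geom_step_le Dup).
Qed.

Lemma nbinom_ge_sub (D : set profile) phi (psi : nat -> profile -> R)
    (C : nat -> R) :
    up_closed D -> bounded_nonneg phi ->
    (forall r l, D l -> psi r l <= C r) -> (forall l, D l -> psi 0%N l <= phi l) ->
    (forall r l, D l -> psi r.+1 l <= geom_step (psi r) (psi r.+1) l) ->
  forall r l, D l -> psi r l <= nbinom r phi l.
Proof.
move=> Dup bphi psi0 base sub; elim=> [//|r IH] l Dl.
apply: (@geom_ge_sub D _ _ (C r.+1)) => //; [exact: bounded_nbinom|exact: psi0|].
move=> l' Dl'; apply: le_trans (sub _ _ Dl') _.
exact: (geom_step_le Dup).
Qed.

Lemma nbinom_le (D : set profile) phi psi : up_closed D ->
    bounded_nonneg phi -> bounded_nonneg psi ->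
    (forall l, D l -> phi l <= psi l) ->
  forall r l, D l -> nbinom r phi l <= nbinom r psi l.
Proof.
move=> Dup bphi bpsi le.
apply: (nbinom_le_super (D := D) (psi := fun r => nbinom r psi)) => //.
  move=> r l _; have [C /(_ l)/andP[]//] := bounded_nbinom r bpsi.
by move=> r l _; rewrite -nbinomS.
Qed.

Lemma nbinom_eq (D : set profile) phi psi : up_closed D ->
    bounded_nonneg phi -> bounded_nonneg psi ->
    (forall l, D l -> phi l = psi l) ->
  forall r l, D l -> nbinom r phi l = nbinom r psi l.
Proof.
move=> Dup bphi bpsi eq r l Dl; apply/le_anti/andP; split.
  by apply: (@nbinom_le D) => // l' /eq ->.
by apply: (@nbinom_le D) => // l' /eq ->.
Qed.

End geometric.

(** * Histories of the walk *)
Section histories.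
Context {b : nat}.
Implicit Types (x y z : vertex b) (hs : seq (vertex b)) (o : option 'I_b).

(** A step is encoded by [Some i] for a jump to the [i]-th son and by [None] for a
    step to the father. Distinct codes lead to distinct vertices, even at the
    root, so that steps can be recovered from the trajectory. *)
Definition move x o : vertex b := if o is Some i then son x i else father x.

Definition cur hs : vertex b := head (Defs.root b) hs.

(** Histories are lists of positions with the most recent one first. *)
Fixpoint moves hs y o : nat :=
  if hs is z :: hs' then
    (moves hs' y o + [&& hs' != [::], cur hs' == y & z == move y o])%N
  else 0%N.

(** The current position is left out: these are the visits whose outcome is
    already known. *)
Definition past hs x : nat := count_mem x (behead hs).

Lemma move_inj x : injective (move x).
Proof.
have neq i : i :: x <> behead x.
  by move=> /(congr1 size) /=; rewrite size_behead; lia.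
move=> [i|] [j|] //=; first by case=> ->.
  by move/neq.
by move/esym/neq.
Qed.

Lemma moves_cons hs o y o' : hs != [::] ->
  moves (move (cur hs) o :: hs) y o' =
  (moves hs y o' + ((cur hs == y) && (o == o')))%N.
Proof.
move=> hs0 /=; rewrite hs0 /=; case: eqP => //= <-.
by rewrite (inj_eq (@move_inj _)).
Qed.

Lemma past_cons hs z x : hs != [::] ->
  past (z :: hs) x = ((cur hs == x) + past hs x)%N.
Proof. by case: hs. Qed.

Lemma moves_le_past hs y o : (moves hs y o <= past hs y)%N.
Proof.
elim: hs => [//|z [|x hs] IH] //; rewrite past_cons // [leqRHS]addnC.
by apply: leq_add; [exact: IH|case: (cur _ == y) => //=; exact: leq_b1].
Qed.

Lemma moves_le_past_target hs y o : (moves hs y o <= (past hs (move y o)).+1)%N.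
Proof.
suff : (moves hs y o <= count_mem (move y o) hs)%N.
  by case: hs => [//|z hs] /= h; rewrite /past /= -add1n (leq_trans h) // leq_add2r leq_b1.
elim: hs => [//|z hs IH] /=; rewrite addnC leq_add //.
by case: (z == _); rewrite ?andbF ?leq_b1.
Qed.

Lemma moves_mem hs y o : (0 < moves hs y o)%N -> move y o \in hs.
Proof.
elim: hs => [//|z hs IH] /=; rewrite addn_gt0 => /orP[/IH|].
  by rewrite inE => ->; rewrite orbT.
by rewrite lt0b => /and3P[_ _ /eqP ->]; rewrite mem_head.
Qed.

(** Vertices are words read from the leaf up, so that being a descendant of [y]
    means having [y] as a suffix. *)
Lemma suffix_neq x y : suffix y x -> x != y -> exists i, suffix (i :: y) x.
Proof.
move=> /suffixP[s ->]; case/lastP: s => [|s i]; first by rewrite eqxx.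
by move=> _; exists i; rewrite cat_rcons suffix_suffix.
Qed.

Lemma suffix_cons_inj x y i j : suffix (i :: y) x -> suffix (j :: y) x -> i = j.
Proof.
move=> /suffixP[s ->] /suffixP[s' eq].
have := congr1 size eq; rewrite !size_cat => /addIn ss.
by move/eqP: eq; rewrite eqseq_cat // eqseq_cons => /and3P[_ /eqP].
Qed.

Lemma suffix_consr y j x : suffix y (j :: x) = (y == j :: x) || suffix y x.
Proof.
apply/idP/orP => [/suffixP[[|i s] /= eq]|[/eqP ->|h]].
- by left; rewrite eq.
- by right; case: eq => _ ->; exact: suffix_suffix.
- exact: suffix_refl.
- exact: suffix_trans h (suffix_cons _ _).
Qed.

End histories.

Section valid_histories.
Context {R : realType} {b : nat} (M : nat) (q : R).
Implicit Types (x y z : vertex b) (hs : seq (vertex b)) (o : option 'I_b).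

Definition bias hs : R := if (past hs (cur hs) < M)%N then 0 else q.

Definition move_prob hs o : R :=
  if o is Some _ then bias hs / b%:R else 1 - bias hs.

(** The histories of positive probability. The invariants of the walk are proved
    by induction on this predicate. *)
Inductive valid : seq (vertex b) -> Prop :=
| valid_root : valid [:: Defs.root b]
| valid_move hs o : valid hs -> 0 < move_prob hs o ->
    valid (move (cur hs) o :: hs).

Lemma valid_neq0 hs : valid hs -> hs != [::].
Proof. by case. Qed.

(** The tree has no cycle: every excursion into the subtree of a vertex ends by
    the edge through which it began, so entrances and exits balance unless the
    walk is inside. *)
Lemma valid_flow hs : valid hs -> forall i y,
  moves hs y (Some i) = (moves hs (i :: y) None + suffix (i :: y) (cur hs))%N.
Proof.
elim=> [|{}hs o vhs IH _] i y; first by rewrite /= suffixs0.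
have hs0 := valid_neq0 vhs; rewrite !moves_cons // {}IH.
set x := cur hs; rewrite /= -/x.
case: o => [j|]; rewrite /= ?andbF ?andbT ?addn0 /son /father.
  rewrite suffix_consr eqseq_cons -addnA; congr (_ + _)%N.
  have -> : (Some j == Some i) = (i == j) by rewrite eq_sym.
  case: (boolP (x == y)) => [/eqP <-|xy]; last first.
    by rewrite (eq_sym y) (negbTE xy) andbF addn0.
  have -> : suffix (i :: x) x = false.
    by apply/negbTE/negP => /size_suffix /=; rewrite ltnn.
  by rewrite eqxx andbT orbF.
rewrite -addnA; congr (_ + _)%N.
case: x => [//|j x] /=; rewrite suffix_consr (eq_sym (j :: x)) eqseq_cons.
case: (boolP ((i == j) && _)) => [/andP[/eqP -> /eqP ->]|_]; last by [].
rewrite (_ : suffix (j :: x) x = false) //.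
by apply/negbTE/negP => /size_suffix /=; rewrite ltnn.
Qed.

(** While a cookie of strength 0 is left, a visit must end by a return to the
    father. *)
Lemma valid_digging hs : valid hs -> forall y,
  (minn (past hs y) M <= moves hs y None)%N.
Proof.
elim=> [|{}hs o vhs IH pos] y; first by rewrite /past /= min0n.
have hs0 := valid_neq0 vhs; rewrite moves_cons // past_cons //.
case: eqP => [eq|_] /=; last by rewrite addn0 add0n IH.
have := IH y; rewrite add1n; case: o pos => [i|] /=; last by lia.
rewrite /bias eq; case: (ltnP (past hs y) M); last by lia.
by rewrite mul0r ltxx.
Qed.

Lemma valid_size hs : valid hs -> all (fun y => (size y < size hs)%N) hs.
Proof.
elim=> [//|{}hs o vhs IH _] /=; apply/andP; split.
  have : (size (cur hs) < size hs)%N.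
    by case: hs IH vhs => [|z hs] /=; [move=> _ /valid_neq0|case/andP].
  by case: o => [i|] /=; rewrite ?ltnS // size_behead; lia.
by apply: sub_all IH => y /=; lia.
Qed.

End valid_histories.

(** * The branching process and its conditional extinction probability *)
Section exploration.
Context {R : realType} (b M : nat) (q : R).
Context (b_gt0 : (0 < b)%N) (q_gt0 : 0 < q) (q_lt1 : q < 1).
Implicit Types (x y z : vertex b) (o : option 'I_b).

(** All that matters about a history: how many times each step has been made
    from each vertex. *)
Definition jumps := vertex b -> option 'I_b -> nat.

Implicit Types S : jumps.

Definition add_move S x o : jumps :=
  fun y o' => (S y o' + ((x == y) && (o == o')))%N.

Definition son_profile S y : profile b := [ffun i => S y (Some i)].

(** Suppose that a vertex returns to its father [k] times. The first [M] returns
    eat the cookies, and the last [k - M] ones each come with a geometric number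
    of jumps to the sons; every jump to a son has to come back. The numbers of
    jumps along the edges therefore form a branching process whose types are
    integers, and [extinct L k] is the probability that, started from [k], it has
    died out by generation [L]. *)
Fixpoint extinct L (k : nat) : R :=
  if L is L'.+1 then
    nbinom q (k - M) (fun l : profile b => \prod_i extinct L' (l i)) [ffun=> 0%N]
  else (k == 0%N)%:R.

(** The same probability given what the jumps [S] reveal: the subtree of [y] must
    in the end return [t] times to the father of [y], of which [S y None] returns
    have been made, and each son has already been entered [S y (Some i)]
    times. The truncation [maxn _ M] discards the returns that the cookies
    force. *)
Fixpoint cond_extinct L S y (t : nat) : R :=
  if L is L'.+1 then
    nbinom q (maxn t M - maxn (S y None) M)
      (fun l : profile b => \prod_i cond_extinct L' S (i :: y) (l i))
      (son_profile S y)
  else (t == 0%N)%:R.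

Lemma prod_unit (F : 'I_b -> R) : (forall i, 0 <= F i <= 1) -> 0 <= \prod_i F i <= 1.
Proof.
move=> h; rewrite prodr_ge0 /=; first by apply: prodr_ile1.
by move=> i _; have /andP[] := h i.
Qed.

Lemma extinct_unit L k : 0 <= extinct L k <= 1.
Proof.
elim: L k => [|L IH] k /=; first by case: eqP; rewrite ?lexx ?ler01.
by apply: nbinom_bound => // l; exact: prod_unit.
Qed.

Lemma cond_extinct_unit L S y t : 0 <= cond_extinct L S y t <= 1.
Proof.
elim: L y t => [|L IH] y t /=; first by case: eqP; rewrite ?lexx ?ler01.
by apply: nbinom_bound => // l; exact: prod_unit.
Qed.

Lemma bounded_extinct L :
  bounded_nonneg (fun l : profile b => \prod_i extinct L (l i)).
Proof. by exists 1 => l; apply: prod_unit => i; exact: extinct_unit. Qed.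

Lemma bounded_cond_extinct L S y :
  bounded_nonneg (fun l : profile b => \prod_i cond_extinct L S (i :: y) (l i)).
Proof. by exists 1 => l; apply: prod_unit => i; exact: cond_extinct_unit. Qed.

(** The quantity attached to [y] only involves the jumps made from the
    descendants of [y]. *)
Lemma cond_extinct_local L S S' y t :
    (forall z o, suffix y z -> S z o = S' z o) ->
  cond_extinct L S y t = cond_extinct L S' y t.
Proof.
elim: L y t => [//|L IH] y t eq /=.
rewrite (eq y None (suffix_refl y)); congr (nbinom _ _ _ _).
  apply/funext => l; apply: eq_bigr => i _; apply: IH => z o h.
  exact/eq/(catl_suffix (s := [:: i])).
by apply/ffunP => i; rewrite !ffunE eq // suffix_refl.
Qed.

Lemma cond_extinct_off_path L S x o y t : ~~ suffix y x ->
  cond_extinct L (add_move S x o) y t = cond_extinct L S y t.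
Proof.
move=> nyx; apply: cond_extinct_local => z o' yz; rewrite /add_move.
by case: eqP => [xz|]; rewrite ?addn0 //; rewrite xz yz in nyx.
Qed.

Lemma cond_extinct0 L y t : cond_extinct L (fun _ _ => 0%N) y t = extinct L t.
Proof.
elim: L y t => [//|L IH] y t /=.
have -> : (maxn t M - maxn 0 M = t - M)%N by lia.
have -> : son_profile (fun _ _ => 0%N) y = [ffun=> 0%N].
  by apply/ffunP => i; rewrite !ffunE.
congr (nbinom _ _ _ _); apply/funext => l; exact: eq_bigr.
Qed.

(** Mean of a function of the next step when the current strength is [s]. *)
Definition step_mean (s : R) (F : option 'I_b -> R) : R :=
  (1 - s) * F None + s / b%:R * \sum_i F (Some i).

Lemma step_mean_const s c : step_mean s (fun=> c) = c.
Proof.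
rewrite /step_mean sumr_const card_ord -[c *+ b]mulr_natl.
by field; rewrite pnatr_eq0 -lt0n.
Qed.

(** The martingale property. A step from [x] reveals one new outcome at [x]. At
    [x] itself this is the one-step equation of [nbinom], or no information at
    all when a cookie forces the return. At a strict ancestor, only the factor of
    the son leading to [x] changes, and [nbinom] is linear in it. That son has been
    entered more often than it has returned since the walk is inside its
    subtree, and the induction hypothesis applies to every profile
    that extends the present one. *)
Lemma cond_extinct_step L S x y t (s : R) :
    suffix y x -> (size x < size y + L)%N ->
    (forall i z, suffix (i :: z) x -> (S (i :: z) None < S z (Some i))%N) ->
    (S y None < t)%N ->
    (s = 0 /\ (S x None < M)%N) \/ (s = q /\ (M <= S x None)%N) ->
  step_mean s (fun o => cond_extinct L (add_move S x o) y t) = cond_extinct L S y t.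
Proof.
move=> + + inside + cookie.
elim: L y t => [|L IH] y t yx xL yt; first by rewrite addn0 ltnNge size_suffix in xL.
case: (eqVneq x y) => [eqxy|xy].
  subst y; have bN : add_move S x None x None = (S x None).+1.
    by rewrite /add_move !eqxx addn1.
  have bS i o : add_move S x o x (Some i) = (S x (Some i) + (o == Some i))%N.
    by rewrite /add_move eqxx.
  have bSN i : add_move S x (Some i) x None = S x None by rewrite /add_move andbF addn0.
  have same o : (fun l : profile b => \prod_i cond_extinct L (add_move S x o) (i :: x) (l i)) =
      (fun l : profile b => \prod_i cond_extinct L S (i :: x) (l i)).
    apply/funext => l; apply: eq_bigr => i _; apply: cond_extinct_off_path.
    by apply/negP => /size_suffix /=; rewrite ltnn.
  have profN : son_profile (add_move S x None) x = son_profile S x.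
    by apply/ffunP => i; rewrite !ffunE bS addn0.
  case: cookie => [[-> dig]|[-> late]].
    rewrite /step_mean subr0 mul1r mul0r mul0r addr0 /= bN same profN.
    by congr (nbinom _ _ _ _); lia.
  rewrite /step_mean /= bN same profN.
  under eq_bigr => i _ do rewrite bSN same.
  have -> : (maxn t M - maxn (S x None).+1 M = t - (S x None).+1)%N by lia.
  have -> : (maxn t M - maxn (S x None) M = (t - (S x None).+1).+1)%N by lia.
  rewrite [RHS]nbinomS //; last exact: bounded_cond_extinct.
  congr (_ + _ * _); apply: eq_bigr => i _; congr (nbinom _ _ _ _).
  by apply/ffunP => j; rewrite !ffunE bS; congr (_ + _)%N; rewrite eq_sym.
have [i0 i0x] := suffix_neq yx xy.
have bE o o' : add_move S x o y o' = S y o' by rewrite /add_move (negbTE xy) addn0.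
have prE o : son_profile (add_move S x o) y = son_profile S y.
  by apply/ffunP => i; rewrite !ffunE bE.
have s01 : 0 <= s <= 1.
  by case: cookie => [[-> _]|[-> _]]; rewrite ?lexx ?ler01 // !ltW.
have bdd o := bounded_cond_extinct L (add_move S x o) y.
have bddS := bounded_cond_extinct L S y.
have sb0 : 0 <= s / b%:R by rewrite divr_ge0 //; case/andP: s01.
have s10 : 0 <= 1 - s by rewrite subr_ge0; case/andP: s01.
rewrite /step_mean /= bE prE.
under eq_bigr => i _ do rewrite bE prE.
set r := (_ - _)%N.
have bsum : bounded_nonneg (fun l : profile b => s / b%:R *
    \sum_j \prod_i cond_extinct L (add_move S x (Some j)) (i :: y) (l i)).
  by apply: boundedZ => //; apply: bounded_sum => j; exact: bdd.
transitivity (nbinom q r (fun l : profile b => step_mean s (fun o =>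
    \prod_i cond_extinct L (add_move S x o) (i :: y) (l i))) (son_profile S y)).
  rewrite /step_mean nbinomD //; last by exact: boundedZ.
  rewrite nbinomZ // nbinomZ //; last by apply: bounded_sum => j; exact: bdd.
  by rewrite nbinom_sum // => j; exact: bdd.
apply: (@nbinom_eq _ _ _ _ _ _ [set l : profile b | (S y (Some i0) <= l i0)%N]) => //.
- by move=> l j /=; rewrite ffunE; lia.
- apply: boundedD; last exact: bsum.
  by apply: boundedZ.
- move=> l /= li0.
  have fac o : \prod_i cond_extinct L (add_move S x o) (i :: y) (l i) =
      cond_extinct L (add_move S x o) (i0 :: y) (l i0) *
      \prod_(i | i != i0) cond_extinct L S (i :: y) (l i).
    rewrite (bigD1 i0) //=; congr (_ * _); apply: eq_bigr => i ii0.
    apply: cond_extinct_off_path; apply/negP => ix.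
    by rewrite (suffix_cons_inj ix i0x) eqxx in ii0.
  rewrite [RHS](bigD1 i0) //= -(IH (i0 :: y)) //=; first last.
  + by apply: leq_trans li0; exact: inside.
  + by lia.
  rewrite /step_mean fac (eq_bigr _ (fun i _ => fac (Some i))) -mulr_suml.
  by ring.
- by rewrite /= ffunE.
Qed.

(** If every entrance has been matched by a return and nothing has entered
    generation [N], the outcome is known: all the remaining numbers of returns
    are 0. *)
Lemma cond_extinct_complete N L S y : (0 < N)%N -> (size y + L = N)%N ->
    (forall i z, S z (Some i) = S (i :: z) None) ->
    (forall i z, size (i :: z) = N -> S z (Some i) = 0%N) ->
  cond_extinct L S y (S y None) = 1.
Proof.
move=> N0 + flow top; elim: L y => [|L IH] y yL /=.
  case: y yL => [|i y] yL; first by rewrite -yL in N0.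
  by rewrite -flow top // -yL addn0.
rewrite subnn /= big1 // => i _; rewrite ffunE flow; apply: IH => /=.
by rewrite -yL addnS.
Qed.

(** One jump into the last generation annihilates a factor of the product at each
    of its ancestors. *)
Lemma cond_extinct_reached L S y i z t : suffix y z ->
    (size z + 1 = size y + L)%N -> (0 < S z (Some i))%N ->
  cond_extinct L S y t = 0.
Proof.
move=> + + pos; elim: L y t => [|L IH] y t yz zL.
  by have := size_suffix yz; rewrite addn0 in zL; rewrite -zL addn1 ltnn.
have bdd := bounded_cond_extinct L S y.
have null (D : set (profile b)) : up_closed D -> D (son_profile S y) ->
   (forall l : profile b, D l -> exists j, cond_extinct L S (j :: y) (l j) = 0) ->
   cond_extinct L.+1 S y t = 0.
  move=> Dup Dl h /=; transitivity (nbinom q (maxn t M - maxn (S y None) M)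
     (fun=> 0 : R) (son_profile S y)); last by rewrite nbinom_const.
  apply: (nbinom_eq _ _ _ Dup) => //; first exact: bounded_const.
  by move=> l /h[j j0]; rewrite (bigD1 j) //= j0 mul0r.
case: (eqVneq z y) => [eqzy|zy].
  have L0 : L = 0%N by move: zL; rewrite eqzy; lia.
  apply: (null [set l : profile b | 0 < l i]%N).
  - by move=> l j /=; rewrite ffunE; lia.
  - by rewrite /= ffunE -eqzy.
  - by move=> l /= li; exists i; rewrite L0 /= eqn0Ngt li.
have [j jz] := suffix_neq yz zy.
apply: (null setT) => // l _; exists j; apply: IH => //=.
by rewrite zL; lia.
Qed.

End exploration.

(** * Binomial moments of the negative binomial law *)
Section moments.
Context {R : realType} (mu : R).

(** The coefficient of [z ^ d] in [(1 + z) ^ l / (1 - mu z) ^ r]. Since a geometric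
    variable [G] of odds [mu] satisfies [E (1 + z) ^ G = 1 / (1 - mu z)], this is
    the expectation of ['C(l + N, d)] where [N] is a sum of [r] independent copies
    of [G]. *)
Fixpoint moment d r l : R :=
  if d is d'.+1 then 'C(l, d)%:R + mu * \sum_(j < r) moment d' j.+1 l else 1.

Lemma momentS d r l : moment d.+1 r l =
  'C(l, d.+1)%:R + mu * \sum_(j < r) moment d j.+1 l.
Proof. by []. Qed.

Lemma momentSS d r l :
  moment d.+1 r.+1 l = moment d.+1 r l + mu * moment d r.+1 l.
Proof. by rewrite /= big_ord_recr /= mulrDr addrA. Qed.

Lemma moment_l d r l :
  moment d.+1 r l.+1 = moment d.+1 r l + moment d r l.
Proof.
elim: d r => [|d IH] r; first by rewrite /= !bin1 -natr1; ring.
rewrite (momentS _ _ l.+1) (momentS d.+1); under eq_bigr => j _ do rewrite IH.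
rewrite big_split [in LHS]binS natrD [in RHS](momentS d) /=; ring.
Qed.

(** The one-step equation, for [p] the probability of odds [mu]. *)
Lemma moment_fix d r l (p : R) : (1 - p) * mu = p ->
  (1 - p) * moment d r l + p * moment d r.+1 l.+1 = moment d r.+1 l.
Proof.
move=> hp; case: d => [|d]; first by rewrite /=; ring.
rewrite moment_l momentSS.
move: (moment _ _ _) (moment d r.+1 l) => A B.
have -> : p * (A + mu * B + B) = p * A + mu * p * B + p * B by ring.
by rewrite -[in p * B]hp; ring.
Qed.

Lemma moment_at0 d r : moment d.+1 r 0 = 'C(r + d, d.+1)%:R * mu ^+ d.+1.
Proof.
elim: d r => [|d IH] r.
  by rewrite momentS sumr_const card_ord addn0 !bin1 expr1 add0r mulrC.
elim: r => [|r IHr]; first by rewrite momentS big_ord0 add0n !bin_small // mul0r mulr0 addr0.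
rewrite momentSS IHr IH -[(r.+1 + d.+1)%N]/((r + d.+1).+1) binS natrD.
by rewrite addSnnS [mu ^+ d.+2]exprS; ring.
Qed.

Lemma moment_ge0 d r l : 0 <= mu -> 0 <= moment d r l.
Proof.
move=> mu0; elim: d r => [|d IH] r /=; first exact: ler01.
by rewrite addr_ge0 // mulr_ge0 // sumr_ge0.
Qed.

Lemma bin_expn_le (y : R) l d : 0 <= y -> 'C(l, d)%:R * y ^+ d <= (1 + y) ^+ l.
Proof.
move=> y0; elim: l d => [|l IH] [|d].
- by rewrite bin0 !expr0 mulr1.
- by rewrite bin0n /= mul0r expr0 ler01.
- by rewrite bin0 expr0 mul1r exprn_ege1 // lerDl.
rewrite binS natrD mulrDl [(1 + y) ^+ _]exprS mulrDl mul1r lerD //.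
by rewrite exprS mulrCA ler_wpM2l.
Qed.

(** Coefficient bound: [z] is specialized to [y] in the generating function, all of
    whose coefficients are nonnegative. *)
Lemma moment_bound (y : R) d r l : 0 <= mu -> 0 < y -> mu * y < 1 ->
  moment d r l * y ^+ d <= (1 + y) ^+ l / (1 - mu * y) ^+ r.
Proof.
move=> mu0 y0 muy; have y0' := ltW y0.
set w := 1 - mu * y; have w0 : 0 < w by rewrite subr_gt0.
have w1 : w <= 1 by rewrite gerBl mulr_ge0.
have base r' : (1 + y) ^+ l <= (1 + y) ^+ l / w ^+ r'.
  rewrite ler_peMr ?exprn_ge0 ?addr_ge0 // invf_ge1 ?exprn_gt0 //.
  by rewrite exprn_ile1 // ltW.
elim: d r => [|d IH] r.
  by rewrite mul1r; apply: le_trans (base r); rewrite exprn_ege1 // lerDl.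
elim: r => [|r IHr].
  by rewrite /= big_ord0 mulr0 addr0; apply: le_trans (base _); exact: bin_expn_le.
rewrite momentSS mulrDl.
have -> : (1 + y) ^+ l / w ^+ r.+1 =
    (1 + y) ^+ l / w ^+ r + mu * y * ((1 + y) ^+ l / w ^+ r.+1).
  rewrite exprS /w; field.
  by rewrite expf_neq0 /= -/w gt_eqF.
apply: lerD => //; rewrite [y ^+ d.+1]exprS.
have -> : mu * moment d r.+1 l * (y * y ^+ d) =
  mu * y * (moment d r.+1 l * y ^+ d) by ring.
by rewrite ler_wpM2l // mulr_ge0.
Qed.

End moments.

(** * Offspring means and survival *)
Section generations.
Context {R : realType} (b M : nat) (q : R).
Context (b_gt0 : (0 < b)%N) (q_gt0 : 0 < q) (q_lt1 : q < 1).

(** Odds of a jump to one given son against a return to the father; the critical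
    parameter is its power [M.+1]. *)
Definition odds : R := q / (b%:R * (1 - q)).

Definition son_prob : R := odds / (1 + odds).

Lemma odds_gt0 : 0 < odds.
Proof. by rewrite divr_gt0 // mulr_gt0 ?ltr0n // subr_gt0. Qed.

(** For functions of a single coordinate, the jumps to the other sons are
    irrelevant, and the one-step equation becomes that of a geometric variable
    with success probability [son_prob]. *)
Lemma geom_step_coord (A B : nat -> R) i (l : profile b) :
  geom_step q (fun l : profile b => A (l i)) (fun l => B (l i)) l =
  B (l i) + (1 - q + q / b%:R) *
    ((1 - son_prob) * A (l i) + son_prob * B (l i).+1 - B (l i)).
Proof.
rewrite /geom_step (bigD1 i) //= (eq_bigr (fun=> B (l i))); last first.
  by move=> j ji; rewrite ffunE eq_sym (negbTE ji) addn0.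
rewrite sumr_const (cardC1 i) card_ord ffunE eqxx addn1 -[_ *+ b.-1]mulr_natl.
have -> : b.-1%:R = b%:R - 1 :> R by rewrite -subn1 natrB.
have b0 : (b%:R : R) != 0 by rewrite pnatr_eq0 -lt0n.
have q1 : 1 - q != 0 by rewrite subr_eq0 eq_sym lt_eqF.
have d0 : q + b%:R * (1 - q) != 0.
  by rewrite gt_eqF // addr_gt0 // mulr_gt0 ?ltr0n // subr_gt0.
rewrite /son_prob /odds; field.
by rewrite q1 b0 /= addrC.
Qed.

Lemma step_weight_gt0 : 0 < 1 - q + q / b%:R.
Proof. by rewrite addr_gt0 ?subr_gt0 // divr_gt0 // ltr0n. Qed.

Lemma son_prob_odds : (1 - son_prob) * odds = son_prob.
Proof.
rewrite /son_prob; have := odds_gt0; move: odds => m m0.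
by field; rewrite gt_eqF // addr_gt0.
Qed.

Lemma nbinom_coord_ge (A : nat -> R) (B : nat -> nat -> R) (C : nat -> R)
    (i : 'I_b) :
    bounded_nonneg (fun l : profile b => A (l i)) ->
    (forall r k, B r k <= C r) -> (forall k, B 0%N k <= A k) ->
    (forall r k, B r.+1 k <= (1 - son_prob) * B r k + son_prob * B r.+1 k.+1) ->
  forall r (l : profile b), B r (l i) <= nbinom q r (fun l : profile b => A (l i)) l.
Proof.
move=> bA BC BA sub r l.
apply: (nbinom_ge_sub b_gt0 q_gt0 q_lt1 (D := setT)
  (psi := fun r (l : profile b) => B r (l i)) (C := C)) => //.
move=> {}r {}l _; rewrite geom_step_coord lerDl pmulr_rge0 ?step_weight_gt0 //.
by rewrite subr_ge0.
Qed.


(** Mean of the total of [v] over the [b] sons of an individual of type [k]. *)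
Definition offspring_mean (v : nat -> R) (k : nat) : R :=
  nbinom q (k - M) (fun l : profile b => \sum_i v (l i)) [ffun=> 0%N].

Lemma bounded_coord (v : nat -> R) C i : (forall k, 0 <= v k <= C) ->
  bounded_nonneg (fun l : profile b => v (l i)).
Proof. by move=> h; exists C. Qed.

Lemma offspring_mean_coord (v : nat -> R) C k : (forall k, 0 <= v k <= C) ->
  offspring_mean v k =
  \sum_(i < b) nbinom q (k - M) (fun l : profile b => v (l i)) [ffun=> 0%N].
Proof.
move=> h; rewrite /offspring_mean nbinom_sum // => i; exact: bounded_coord h.
Qed.

Lemma offspring_mean_ge0 (v : nat -> R) C k : (forall k, 0 <= v k <= C) ->
  0 <= offspring_mean v k.
Proof.
move=> h; rewrite (offspring_mean_coord k h); apply: sumr_ge0 => i _.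
by have /(_ [ffun=> 0%N])/andP[] := nbinom_bound b_gt0 q_gt0 q_lt1 (k - M)
  (phi := fun l : profile b => v (l i)) (fun l => h (l i)).
Qed.

(** Comparison of the product with the inverse of [1 + \sum_i x i]. *)
Lemma prod_sub_le (x : 'I_b -> R) (eta : R) : (forall i, 0 <= x i <= 1) ->
  \sum_i x i <= eta -> \prod_i (1 - x i) + \sum_i x i / (1 + eta) <= 1.
Proof.
move=> x01 sx; rewrite -mulr_suml.
have s0 : 0 <= \sum_i x i by apply: sumr_ge0 => i _; have /andP[] := x01 i.
have eta0 : 0 <= eta := le_trans s0 sx.
have [p0 ps] : 0 <= \prod_i (1 - x i) /\
    \prod_i (1 - x i) * (1 + \sum_i x i) <= 1.
  have : [/\ 0 <= \prod_i (1 - x i), 0 <= \sum_i x i &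
      \prod_i (1 - x i) * (1 + \sum_i x i) <= 1]; last by case.
  elim/big_rec2 : _ => [|i s p _ [p0 s'0 ps]].
    by rewrite ler01 lexx addr0 mulr1.
  have /andP[xi0 xi1] := x01 i.
  split; [by rewrite mulr_ge0 ?subr_ge0|by rewrite addr_ge0|].
  apply: le_trans ps; rewrite -subr_ge0.
  have -> : p * (1 + s) - (1 - x i) * p * (1 + (x i + s)) =
    p * (x i * x i + x i * s) by ring.
  by rewrite mulr_ge0 // addr_ge0 // mulr_ge0.
move: ps; set p := \prod_i _ in p0 *; set s := \sum_i _ in s0 sx *.
move=> ps; have s1 : 0 < 1 + s by lra.
have eta1 : 0 < 1 + eta by lra.
apply: le_trans (_ : p + s / (1 + s) <= _).
  by rewrite lerD2l ler_wpM2l // lef_pV2 // lerD2l.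
rewrite -(ler_pM2r s1) mul1r mulrDl divfK ?gt_eqF //; lra.
Qed.

Lemma prod_sub_ge (x : 'I_b -> R) : (forall i, 0 <= x i <= 1) ->
  1 - \sum_i x i <= \prod_i (1 - x i).
Proof.
move=> x01.
have [_ _] : [/\ 0 <= \prod_i (1 - x i) <= 1, 0 <= \sum_i x i &
    1 - \sum_i x i <= \prod_i (1 - x i)]; last by [].
elim/big_rec2 : _ => [|i s p _ [/andP[p0 p1] s0 ps]].
  by rewrite ler01 lexx subr0.
have /andP[xi0 xi1] := x01 i.
split; [|by rewrite addr_ge0|by nra].
by rewrite mulr_ge0 ?subr_ge0 //= mulr_ile1 ?subr_ge0 // gerBl.
Qed.

(** A small [v] multiplied by at least [1 + eta] in the mean bounds the survival
    probability from below in every generation. Smallness makes the quadratic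
    terms of [1 - \prod_i (1 - v (l i))] cost less than a factor [1 + eta]. *)
Lemma extinct_le (v : nat -> R) (eta : R) :
    (forall k, 0 <= v k <= 1) -> v 0%N = 0 -> (forall k, b%:R * v k <= eta) ->
    (forall k, (1 + eta) * v k <= offspring_mean v k) ->
  forall L k, extinct b M q L k <= 1 - v k.
Proof.
move=> v01 v0 veta super.
have eta0 : 0 <= eta by have := veta 0%N; rewrite v0 mulr0.
have eta1 : 0 < 1 + eta by lra.
have bv : bounded_nonneg (fun l : profile b => \sum_i v (l i)).
  apply: bounded_sum => i; exact: bounded_coord v01.
have bp : bounded_nonneg (fun l : profile b => \prod_i (1 - v (l i))).
  exists 1 => l; apply: prod_unit => i.
  by have /andP[? ?] := v01 (l i); rewrite subr_ge0 gerBl; apply/andP.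
elim=> [|L IH] k /=.
  case: eqP => [->|_]; first by rewrite v0 subr0.
  by have /andP[? ?] := v01 k; rewrite subr_ge0.
have bT : up_closed [set: profile b] by [].
apply: (@le_trans _ _ (nbinom q (k - M)
    (fun l : profile b => \prod_i (1 - v (l i))) [ffun=> 0%N])).
  apply: (nbinom_le b_gt0 q_gt0 q_lt1 bT) => //.
    exact: bounded_extinct.
  move=> l _; apply: ler_prod => i _; rewrite IH andbT.
  by have /andP[] := extinct_unit M b_gt0 q_gt0 q_lt1 L (l i).
have : nbinom q (k - M) (fun l : profile b => \prod_i (1 - v (l i)) +
    (1 + eta)^-1 * \sum_i v (l i)) [ffun=> 0%N] <=
    nbinom q (k - M) (fun _ : profile b => 1) [ffun=> 0%N].
  have c0 : 0 <= (1 + eta)^-1 by rewrite invr_ge0 ltW.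
  apply: (nbinom_le b_gt0 q_gt0 q_lt1 bT) => //.
  - by apply: boundedD => //; exact: boundedZ.
  - exact: bounded_const.
  - move=> l _; rewrite mulrC mulr_suml; apply: prod_sub_le => //.
    apply: le_trans (_ : \sum_(i < b) eta / b%:R <= _).
      apply: ler_sum => i _; rewrite ler_pdivlMr ?ltr0n // mulrC; exact: veta.
    rewrite sumr_const card_ord -[_ *+ b]mulr_natr divfK //.
    by rewrite pnatr_eq0 -lt0n.
rewrite nbinom_const // nbinomD //; last first.
  by apply: boundedZ => //; rewrite invr_ge0 ltW.
rewrite nbinomZ //; last by rewrite invr_ge0 ltW.
have := super k; rewrite /offspring_mean => sk.
have : v k <= (1 + eta)^-1 * nbinom q (k - M)
    (fun l : profile b => \sum_i v (l i)) [ffun=> 0%N].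
  by rewrite ler_pdivlMl.
lra.
Qed.

(** Any bounded [v] can be scaled down to satisfy the previous requirement. *)
Lemma extinct_lt1_of (v : nat -> R) (C eta : R) K : 0 < C -> 0 < eta ->
    (forall k, 0 <= v k <= C) -> v 0%N = 0 ->
    (forall k, (1 + eta) * v k <= offspring_mean v k) -> 0 < v K ->
  exists2 u : R, u < 1 & forall L, extinct b M q L K <= u.
Proof.
move=> C0 eta0 v01 v0 super vK.
have b0 : 0 < b%:R :> R by rewrite ltr0n.
pose c := Num.min 1 (eta / b%:R) / C.
have c0 : 0 < c by rewrite divr_gt0 // lt_min ltr01 divr_gt0.
have cC : c * C = Num.min 1 (eta / b%:R) by rewrite divfK // gt_eqF.
have cv k : 0 <= c * v k <= c * C.
  by have /andP[? ?] := v01 k; rewrite mulr_ge0 ?(ltW c0) //= ler_pM2l.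
exists (1 - c * v K) => [|L]; first by rewrite gtrBl mulr_gt0.
apply: (extinct_le (v := fun k => c * v k) (eta := eta)) => //.
- move=> k; have /andP[-> h] := cv k; apply: le_trans h _.
  by rewrite cC ge_min lexx.
- by rewrite v0 mulr0.
- move=> k; have /andP[_ h] := cv k; rewrite mulrC -ler_pdivlMr //.
  by apply: le_trans h _; rewrite cC ge_min lexx orbT.
- move=> k; rewrite mulrCA /offspring_mean.
  have -> : (fun l : profile b => \sum_i c * v (l i)) =
      (fun l : profile b => c * \sum_i v (l i)).
    by apply/funext => l; rewrite mulr_sumr.
  rewrite nbinomZ ?(ltW c0) //; first by rewrite ler_pM2l.
  apply: bounded_sum => i; exact: bounded_coord v01.
Qed.

End generations.

(** * The supercritical case *)
Section supercritical.
Context {R : realType} (b M : nat) (q : R).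
Context (b_gt1 : (1 < b)%N) (q_gt0 : 0 < q) (q_lt1 : q < 1).

Let b_gt0 : (0 < b)%N := ltnW b_gt1.
Context (m : R) (mE : m = odds b q).
Let m0 : 0 < m.
Proof. by rewrite mE; exact: odds_gt0. Qed.

(** Polynomial growth against geometric decay: [moment_bound] at [y = 1 - x], for
    which [x * (1 + y) <= 1]. *)
Lemma damped_moment_bound (mu x : R) d r l : 0 <= mu < 1 -> 0 < x < 1 ->
  x ^+ l * moment mu d r l <=
  ((1 - x) ^+ d * (1 - mu * (1 - x)) ^+ r)^-1.
Proof.
move=> /andP[mu0 mu1] /andP[x0 x1].
set y := 1 - x; have y0 : 0 < y by rewrite subr_gt0.
have muy : mu * y < 1 by rewrite (le_lt_trans _ mu1) // ler_piMr // gerBl ltW.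
have := moment_bound d r l mu0 y0 muy.
set w := 1 - mu * y; have w0 : 0 < w by rewrite subr_gt0.
rewrite -ler_pdivlMr ?exprn_gt0 // => h.
apply: le_trans (ler_wpM2l (exprn_ge0 l (ltW x0)) h) _.
have -> : x ^+ l * ((1 + y) ^+ l / w ^+ r / y ^+ d) =
    (x * (1 + y)) ^+ l * (y ^+ d * w ^+ r)^-1.
  by rewrite exprMn invfM; ring.
have yw0 : 0 < y ^+ d * w ^+ r by rewrite mulr_gt0 ?exprn_gt0.
rewrite ler_piMl ?invr_ge0 ?(ltW yw0) //.
have y1 : 0 <= 1 + y by rewrite addr_ge0 // ltW.
apply: exprn_ile1; first exact: mulr_ge0 (ltW x0) y1.
have -> : x * (1 + y) = 1 - y ^+ 2 by rewrite /y; ring.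
by rewrite gerBl sqr_ge0.
Qed.

(** The test function is ['C(k, M.+1) * x ^+ k]. Differentiating [M.+1] times the
    generating function of the negative binomial law shows that its offspring
    mean is [b * mu ^+ M.+1 * 'C(k, M.+1) * f ^+ (k - M)], where
    [f = (1 - p) / (1 - p x)] and [mu = p x / (1 - p x)], with [p = son_prob]. When
    the odds are at most 1 one has [x <= f], and [b * mu ^+ M.+1] exceeds 1 as soon
    as [x] is close enough to 1. *)
Lemma extinct_lt1_small_odds : m <= 1 -> 1 < b%:R * m ^+ M.+1 ->
  exists K, exists2 u : R, u < 1 & forall L, extinct b M q L K <= u.
Proof.
move=> m1 big.
have b0 : 0 < b%:R :> R by rewrite ltr0n.
(* The damping is parametrized by mu < m. It is chosen close to m by means of
   Bernoulli's inequality. *)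
have [mu /andP[mu0 mum] big'] : exists2 mu : R, 0 < mu < m & 1 < b%:R * mu ^+ M.+1.
  have e0 : 0 < b%:R * m ^+ M.+1 by rewrite (lt_trans ltr01).
  have : 0 < (b%:R * m ^+ M.+1)^-1 < 1 by rewrite invr_gt0 e0 invf_lt1.
  have : (b%:R * m ^+ M.+1) * (b%:R * m ^+ M.+1)^-1 = 1 by rewrite mulfV // gt_eqF.
  move: (b%:R * m ^+ M.+1)^-1 => iv ivE /andP[inv0 inv1].
  pose t : R := (1 - iv) / M.+2%:R.
  have M2 : 1 <= M.+2%:R :> R by rewrite ler1n.
  have t0 : 0 < t by rewrite divr_gt0 // subr_gt0.
  have tM : t * M.+2%:R = 1 - iv.
    by rewrite divfK // pnatr_eq0.
  have t1 : t < 1.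
    by apply: le_lt_trans (_ : t * M.+2%:R < 1); rewrite ?tM ?gtrBl // -tM ler_peMr // ltW.
  exists (m * (1 - t)); first by
    rewrite mulr_gt0 ?subr_gt0 //= gtr_pMr // gtrBl.
  have bern n : 1 - n%:R * t <= (1 - t) ^+ n.
    elim: n => [|n IH]; first by rewrite mul0r subr0 expr0.
    rewrite exprS -natr1; apply: le_trans (ler_wpM2l (_ : 0 <= 1 - t) IH).
      rewrite -subr_ge0 (_ : _ - _ = n%:R * t ^+ 2); last by ring.
      by rewrite mulr_ge0 ?sqr_ge0.
    by rewrite subr_ge0 ltW.
  rewrite exprMn mulrA; have := bern M.+1.
  move=> h; apply: lt_le_trans (ler_wpM2l (ltW e0) h).
  have -> : M.+1%:R * t = 1 - iv - t by rewrite -tM -[in RHS]natr1; ring.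
  have -> : b%:R * m ^+ M.+1 * (1 - (1 - iv - t)) = 1 + b%:R * m ^+ M.+1 * t.
    transitivity (b%:R * m ^+ M.+1 * iv + b%:R * m ^+ M.+1 * t); first by ring.
    by rewrite ivE.
  by rewrite ltrDl mulr_gt0.
have mu1 : mu < 1 by exact: lt_le_trans mum m1.
pose f : R := (1 + mu) / (1 + m).
(* x solves x f = mu / m, which is mu = p x / (1 - p x) for p = m / (1 + m). *)
pose x : R := mu / m / f.
have m1' : 0 < 1 + m by lra.
have mu1' : 0 < 1 + mu by lra.
have f0 : 0 < f by rewrite divr_gt0.
have f1 : f <= 1 by rewrite ler_pdivrMr // mul1r lerD2l ltW.
have x0 : 0 < x by rewrite divr_gt0 // divr_gt0.
have xE : x = mu * (1 + m) / (m * (1 + mu)).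
  by rewrite /x /f; field; rewrite !gt_eqF.
have x1 : x < 1.
  by rewrite xE ltr_pdivrMr ?mulr_gt0 //; lra.
have xf : x <= f.
  rewrite xE /f ler_pdivrMr ?mulr_gt0 // mulrAC ler_pdivlMr //.
  rewrite -subr_ge0.
  have -> : (1 + mu) * (m * (1 + mu)) - mu * (1 + m) * (1 + m) =
    (m - mu) * (1 - m * mu) by ring.
  by rewrite mulr_ge0 ?subr_ge0 ?(ltW mum) // mulr_ile1 // ltW.
pose v k := 'C(k, M.+1)%:R * x ^+ k.
pose psi r k := x ^+ k * f ^+ r * moment mu M.+1 r k.
pose C0 := ((1 - x) ^+ M.+1)^-1.
have w0 : 0 < 1 - mu * (1 - x).
  by rewrite subr_gt0 (le_lt_trans _ mu1) // ler_piMr ?(ltW mu0) // gerBl ltW.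
have mu01 : 0 <= mu < 1 by rewrite mu1 ltW.
have x01 : 0 < x < 1 by rewrite x0.
have vC k : 0 <= v k <= C0.
  rewrite mulr_ge0 ?exprn_ge0 ?(ltW x0) //=.
  have := damped_moment_bound M.+1 0 k mu01 x01.
  by rewrite expr0 mulr1 momentS big_ord0 mulr0 addr0 mulrC.
exists M.+1.
apply: (extinct_lt1_of b_gt0 q_gt0 q_lt1 (v := v) (C := C0)
  (eta := b%:R * mu ^+ M.+1 - 1)).
- by rewrite invr_gt0 exprn_gt0 // subr_gt0.
- by rewrite subr_gt0.
- exact: vC.
- by rewrite /v bin0n mul0r.
- move=> k; rewrite addrC subrK (offspring_mean_coord M b_gt0 q_gt0 q_lt1 k vC).
  have [kM|Mk] := leqP k M.
    rewrite /v bin_small // mul0r mulr0; apply: sumr_ge0 => i _.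
    by have /(_ [ffun=> 0%N])/andP[] := nbinom_bound b_gt0 q_gt0 q_lt1 (k - M)
      (phi := fun l : profile b => v (l i)) (fun l => vC (l i)).
  apply: le_trans (_ : \sum_(i < b) psi (k - M)%N 0%N <= _); last first.
    apply: ler_sum => i _.
    have h0 : [ffun=> 0%N] i = 0%N by rewrite ffunE.
    rewrite -[X in psi _ X]h0.
    apply: (nbinom_coord_ge b_gt0 q_gt0 q_lt1
      (C := fun r => f ^+ r * ((1 - x) ^+ M.+1 * (1 - mu * (1 - x)) ^+ r)^-1)).
    + exact: bounded_coord vC.
    + move=> r l; rewrite /psi [x ^+ _ * _]mulrC -mulrA; apply: ler_wpM2l.
        by rewrite exprn_ge0 // ltW.
      exact: damped_moment_bound.
    + by move=> l; rewrite /psi momentS big_ord0 mulr0 addr0 mulr1 mulrC.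
    + move=> r l; rewrite /psi.
      have hp : (1 - mu / (1 + mu)) * mu = mu / (1 + mu) by field; rewrite gt_eqF.
      rewrite -(moment_fix M.+1 r l hp).
      move: (moment _ _ _ _) (moment _ _ _ l.+1) => A B.
      rewrite /son_prob -mE /x /f !exprS.
      rewrite le_eqVlt; apply/orP; left; apply/eqP.
      field; rewrite ?gt_eqF //.
  rewrite sumr_const card_ord -[leRHS]mulr_natl /psi expr0 mul1r moment_at0.
  rewrite subnK 1?ltnW // /v.
  have -> : b%:R * mu ^+ M.+1 * ('C(k, M.+1)%:R * x ^+ k) =
    b%:R * mu ^+ M.+1 * 'C(k, M.+1)%:R * x ^+ k by rewrite mulrA.
  have -> : b%:R * (f ^+ (k - M) * ('C(k, M.+1)%:R * mu ^+ M.+1)) =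
    b%:R * mu ^+ M.+1 * 'C(k, M.+1)%:R * f ^+ (k - M) by ring.
  apply: ler_wpM2l; first by rewrite !mulr_ge0 ?exprn_ge0 ?(ltW mu0).
  apply: le_trans (_ : x ^+ (k - M) <= _).
    by rewrite ler_wiXn2l ?(ltW x0) ?(ltW x1) // leq_subr.
  by rewrite lerXn2r // nnegrE ltW.
- by rewrite /v binn mul1r exprn_gt0.
Qed.

(** A large type is now likely to have a larger offspring in every son. The test
    function [1 - y ^+ (k - A)], cut at 0, captures this for [y] between [m^-1]
    and 1: for those [y], the generating function [f] of the geometric law
    satisfies [f < y], and its gain over [y] beats the loss of [M] returns for
    types above a large [A]. *)
Lemma extinct_lt1_large_odds : 1 < m ->
  exists K, exists2 u : R, u < 1 & forall L, extinct b M q L K <= u.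
Proof.
move=> m1.
(* The midpoint of the two fixed points m^-1 and 1 of the generating function. *)
pose y : R := (1 + m^-1) / 2.
pose f : R := (1 - son_prob b q) / (1 - son_prob b q * y).
have /andP[mV0 mV1] : 0 < m^-1 < 1 by rewrite invr_gt0 m0 invf_lt1.
have y0 : 0 < y by rewrite /y; lra.
have y1 : y < 1 by rewrite /y; lra.
have pE : son_prob b q = m / (1 + m) by rewrite /son_prob -mE.
have m1' : 0 < 1 + m by lra.
have d0 : 0 < 1 + m * (1 - y) by rewrite addr_gt0 // mulr_gt0 // subr_gt0.
have fE : f = (1 + m * (1 - y))^-1.
  rewrite /f pE; field; rewrite ?gt_eqF //.
have f0 : 0 < f by rewrite fE invr_gt0.
have my : 1 < m * y.
  by rewrite /y mulrA mulrDr mulr1 mulfV ?gt_eqF //; lra.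
have fy : f < y.
  rewrite fE -[ltLHS]mul1r ltr_pdivrMr // -subr_gt0.
  have -> : y * (1 + m * (1 - y)) - 1 = (1 - y) * (m * y - 1) by ring.
  by rewrite mulr_gt0 // subr_gt0.
have fy0 : 0 < f / y < 1 by rewrite divr_gt0 //= ltr_pdivrMr // mul1r.
have [A [A0 MA fA]] : exists A, [/\ (0 < A)%N, (M < A)%N & (f / y) ^+ A <= f ^+ M].
  have /cvgrPdist_lt/(_ (f ^+ M)) : (f / y) ^+ n @[n --> \oo] --> (0 : R).
    by apply: cvg_expr; have /andP[? ?] := fy0; rewrite ger0_norm // ltW.
  rewrite exprn_gt0 // => /(_ isT)[N _ hN].
  exists (N + M.+1)%N; split; [by rewrite addnS|by rewrite addnS ltnS leq_addl|].
  have := hN (N + M.+1)%N (leq_addr _ _) => /=.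
  rewrite sub0r normrN ger0_norm; first exact: ltW.
  by rewrite exprn_ge0 //; have /andP[? _] := fy0; exact: ltW.
pose v k := Num.max 0 (1 - y ^+ k / y ^+ A).
have yA : 0 < y ^+ A by rewrite exprn_gt0.
have yk k : 0 < y ^+ k by rewrite exprn_gt0.
have vC k : 0 <= v k <= 1.
  by rewrite /v le_max lexx /= ge_max ler01 gerBl divr_ge0 // ltW.
have vle k : (k <= A)%N -> v k = 0.
  move=> kA; rewrite /v max_l // subr_le0 ler_pdivlMr // mul1r.
  by rewrite ler_wiXn2l // ltW.
have vgt k : (A < k)%N -> v k = 1 - y ^+ k / y ^+ A.
  move=> Ak; rewrite /v max_r // subr_ge0 ler_pdivrMr // mul1r.
  by rewrite ler_wiXn2l ?ltW // ltnW.
exists A.+1.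
apply: (extinct_lt1_of b_gt0 q_gt0 q_lt1 (v := v) (C := 1)
  (eta := b%:R - 1)) => //.
- by rewrite subr_gt0 ltr1n.
- by rewrite vle.
- move=> k; rewrite addrC subrK.
  have [kA|Ak] := leqP k A.
    by rewrite vle // mulr0; exact: (offspring_mean_ge0 M b_gt0 q_gt0 q_lt1 k vC).
  rewrite (offspring_mean_coord M b_gt0 q_gt0 q_lt1 k vC).
  apply: le_trans (_ : \sum_(i < b) (1 - y ^+ 0 / y ^+ A * f ^+ (k - M)) <= _); last first.
    apply: ler_sum => i _.
    have h0 : [ffun=> 0%N] i = 0%N by rewrite ffunE.
    rewrite -[X in y ^+ X]h0.
    apply: (nbinom_coord_ge b_gt0 q_gt0 q_lt1
      (B := fun r k => 1 - y ^+ k / y ^+ A * f ^+ r) (C := fun=> 1)).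
    + exact: bounded_coord vC.
    + by move=> r l; rewrite gerBl mulr_ge0 ?divr_ge0 ?exprn_ge0 // ltW.
    + by move=> l; rewrite expr0 mulr1 /v le_max lexx orbT.
    + move=> r l; rewrite le_eqVlt; apply/orP; left.
      have fp : (1 - son_prob b q) + son_prob b q * y * f - f = 0.
        by rewrite fE pE; field; rewrite !gt_eqF.
      rewrite !exprS -subr_eq0.
      set t := son_prob b q in fp *.
      have -> : 1 - y ^+ l / y ^+ A * (f * f ^+ r) -
          ((1 - t) * (1 - y ^+ l / y ^+ A * f ^+ r) +
           t * (1 - y * y ^+ l / y ^+ A * (f * f ^+ r))) =
          y ^+ l / y ^+ A * f ^+ r * (1 - t + t * y * f - f) by ring.
      by rewrite fp mulr0.
  rewrite sumr_const card_ord -[leRHS]mulr_natl.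
  apply: ler_wpM2l => //; rewrite vgt // lerD2l lerN2 expr0 div1r mulrC.
  rewrite ler_wpM2r ?invr_ge0 ?(ltW yA) //.
  have kM : (M <= k)%N by rewrite ltnW // (ltn_trans MA).
  have fM : 0 < f ^+ M by rewrite exprn_gt0.
  rewrite -(ler_pM2r fM) -exprD subnK // mulrC -ler_pdivrMr // -expr_div_n.
  apply: le_trans fA; rewrite ler_wiXn2l ?(ltnW Ak) //;
    by have /andP[? ?] := fy0; exact: ltW.
- rewrite vgt // subr_gt0 ltr_pdivrMr // mul1r.
  by rewrite ltr_iXn2l.
Qed.

Lemma extinct_lt1 : 1 < b%:R * m ^+ M.+1 ->
  exists K, exists2 u : R, u < 1 & forall L, extinct b M q L K <= u.
Proof.
by case: (leP m 1) => [|m1 _]; [exact: extinct_lt1_small_odds|exact: extinct_lt1_large_odds].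
Qed.

End supercritical.

(** * The critical and subcritical cases *)
Section critical.
Context {R : realType} (b M : nat) (q : R).
Context (b_gt0 : (0 < b)%N) (q_gt0 : 0 < q) (q_lt1 : q < 1).
Context (le1 : b%:R * odds b q ^+ M.+1 <= 1).

(* By moment_at0 the offspring mean of g is b * odds ^ M.+1 * g, so g is
   superharmonic. *)
Let g k : R := 'C(k, M.+1)%:R.

Let g_ge0 k : 0 <= g k.
Proof. exact: ler0n. Qed.

Let g0 k : (k <= M)%N -> g k = 0.
Proof. by move=> kM; rewrite /g bin_small. Qed.

Let g_ge1 k : (M < k)%N -> 1 <= g k.
Proof. by move=> Mk; rewrite /g ler1n bin_gt0. Qed.

Let g_unbounded (C : R) : exists n, C < g n.
Proof.
have h j : (j <= 'C(j + M.+1, M.+1))%N.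
  elim: j => [//|j IH]; rewrite addSn binS.
  have : (0 < 'C(j + M.+1, M))%N by rewrite bin_gt0; lia.
  lia.
exists ((Num.truncn C).+1 + M.+1)%N.
apply: lt_le_trans (_ : (Num.truncn C).+1%:R <= _); first exact: truncnS_gt.
by rewrite ler_nat.
Qed.

Let capped C k : R := Num.min C (g k).

Let capped_bound C k : 0 <= C -> 0 <= capped C k <= C.
Proof. by move=> C0; rewrite /capped le_min C0 g_ge0 /= ge_min lexx. Qed.

Let growth r (l : profile b) : R :=
  \sum_i moment (odds b q) M.+1 r (l i).

Let growth_fix r (l : profile b) : geom_step q (growth r) (growth r.+1) l = growth r.+1 l.
Proof.
have lin (A B : nat -> R) : geom_step q (fun l : profile b => \sum_i A (l i))
    (fun l : profile b => \sum_i B (l i)) l =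
    \sum_i geom_step q (fun l : profile b => A (l i)) (fun l => B (l i)) l.
  by rewrite /geom_step exchange_big big_split /= -!mulr_sumr.
rewrite /growth lin.
apply: eq_bigr => i _; rewrite geom_step_coord // moment_fix ?son_prob_odds //.
by rewrite subrr mulr0 addr0.
Qed.

Let growth_ge0 r l : 0 <= growth r l.
Proof.
by apply: sumr_ge0 => i _; apply: moment_ge0; exact: ltW (odds_gt0 _ _ _).
Qed.

(** Capping [g] makes the decrease strict, even at criticality, because types with
    [g] above the cap are reached with positive probability. *)
Lemma capped_mean_lt C k : 0 <= C -> (M < k)%N ->
  offspring_mean b M q (capped C) k < g k.
Proof.
move=> C0 Mk.
pose phi (l : profile b) : R := \sum_i capped C (l i).
have bphi : bounded_nonneg phi.
  by apply: bounded_sum => i; apply: (bounded_coord (C := C)) => j; exact: capped_bound.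
have growth0 l : growth 0 l = \sum_i g (l i).
  by apply: eq_bigr => i _; rewrite momentS big_ord0 mulr0 addr0.
have le r l : nbinom q r phi l <= growth r l.
  apply: (nbinom_le_super b_gt0 q_gt0 q_lt1 (D := setT) (psi := growth)) => //.
    move=> {}l _; rewrite growth0; apply: ler_sum => i _.
    by rewrite /capped ge_min lexx orbT.
  by move=> {}r {}l _; rewrite growth_fix.
pose pos r l := nbinom q r phi l < growth r l.
have diff r (l : profile b) : growth r.+1 l - nbinom q r.+1 phi l =
    (1 - q) * (growth r l - nbinom q r phi l) + q / b%:R *
    \sum_i (growth r.+1 (incr l i) - nbinom q r.+1 phi (incr l i)).
  rewrite nbinomS // -growth_fix /geom_step sumrB; ring.
have qb0 : 0 < q / b%:R by rewrite divr_gt0 // ltr0n.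
have sumD r (l : profile b) : 0 <= \sum_i
    (growth r.+1 (incr l i) - nbinom q r.+1 phi (incr l i)).
  by apply: sumr_ge0 => i _; rewrite subr_ge0 le.
have posS r l : pos r l -> pos r.+1 l.
  rewrite /pos -subr_gt0 => h; rewrite -subr_gt0 diff; apply: ltr_pwDl.
    by rewrite mulr_gt0 // subr_gt0.
  exact: mulr_ge0 (ltW qb0) (sumD _ _).
(* A positive defect propagates to the profiles one jump below, and with posS
   to one more return. *)
have pos_back r l i : pos r.+1 (incr l i) -> pos r.+1 l.
  rewrite /pos -subr_gt0 => h; rewrite -subr_gt0 diff; apply: ltr_wpDl.
    by rewrite mulr_ge0 ?subr_ge0 ?le // ltW.
  rewrite mulr_gt0 // (bigD1 i) //=; apply: ltr_pwDl => //.
  by apply: sumr_ge0 => j _; rewrite subr_ge0; exact: (le r.+1).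
have [n gn] := g_unbounded C.
pose i0 : 'I_b := Ordinal b_gt0.
pose up j : profile b := [ffun i => (j * (i == i0))%N].
have upS j : up j.+1 = incr (up j) i0.
  by apply/ffunP => i; rewrite !ffunE; case: (i == i0); lia.
have pos0 r : pos r (up n).
  elim: r => [|r IH]; last exact: posS.
  rewrite /pos growth0 /nbinom /= /phi (bigD1 i0) //= [ltRHS](bigD1 i0) //=.
  rewrite ffunE eqxx muln1; apply: ltr_leD.
    by rewrite /capped gt_min gn.
  by apply: ler_sum => i _; rewrite /capped ge_min lexx orbT.
have [r kr] : exists r, (k - M = r.+1)%N by exists (k - M.+1)%N; lia.
have posn j : pos r.+1 (up j) -> pos r.+1 (up 0%N).
  by elim: j => // j IH; rewrite upS => /pos_back.
have up0 : up 0%N = [ffun=> 0%N] by apply/ffunP => i; rewrite !ffunE mul0n.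
have := posn n (pos0 r.+1); rewrite /pos up0 -kr /offspring_mean => h.
apply: lt_le_trans h _; rewrite /growth.
under eq_bigr => i _ do rewrite ffunE moment_at0.
rewrite sumr_const card_ord subnK 1?ltnW // -[leLHS]mulr_natl mulrCA.
by rewrite ler_piMr.
Qed.

Lemma capped_mean_contract C n : 0 <= C -> exists2 kappa : R, 0 <= kappa < 1 &
  forall k, (k <= n)%N -> offspring_mean b M q (capped C) k <= kappa * g k.
Proof.
move=> C0; have small k : (k <= M)%N -> offspring_mean b M q (capped C) k = 0.
  move=> kM; rewrite /offspring_mean (eqP kM : (k - M)%N = 0%N) /nbinom /=.
  by rewrite big1 // => i _; rewrite ffunE /capped g0 // min_r.
elim: n => [|n [kappa /andP[k0 k1] IH]].
  exists 0; first by rewrite lexx ltr01.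
  by move=> k; rewrite leqn0 => /eqP ->; rewrite small // mul0r.
have [nM|Mn] := leqP n.+1 M.
  exists 0; first by rewrite lexx ltr01.
  by move=> k kn; rewrite small ?mul0r // (leq_trans kn).
have gn : 0 < g n.+1 by apply: lt_le_trans (g_ge1 Mn).
pose t := offspring_mean b M q (capped C) n.+1 / g n.+1.
have t1 : t < 1 by rewrite ltr_pdivrMr // mul1r; exact: capped_mean_lt.
exists (Num.max kappa t); first by rewrite le_max k0 /= gt_max k1.
move=> k; rewrite leq_eqVlt ltnS => /orP[/eqP ->|kn].
  by rewrite -ler_pdivrMr // le_max lexx orbT.
by apply: le_trans (IH _ kn) _; rewrite ler_wpM2r // le_max lexx.
Qed.

Lemma survival_le_mean L k :
  1 - extinct b M q L.+1 k <= offspring_mean b M q (fun k => 1 - extinct b M q L k) k.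
Proof.
have eu := extinct_unit M b_gt0 q_gt0 q_lt1 L.
have s01 j : 0 <= 1 - extinct b M q L j <= 1.
  by have /andP[? ?] := eu j; rewrite subr_ge0 gerBl; apply/andP.
have bs : bounded_nonneg (fun l : profile b => \sum_i (1 - extinct b M q L (l i))).
  apply: bounded_sum => i; exact: (bounded_coord (v := fun k => 1 - extinct b M q L k) _ s01).
have be := bounded_extinct M b_gt0 q_gt0 q_lt1 L.
rewrite /offspring_mean lerBlDr /=.
rewrite -[X in _ <= X]/((fun l => nbinom q (k - M) (fun l : profile b =>
   \sum_i (1 - extinct b M q L (l i))) l + nbinom q (k - M) (fun l : profile b =>
   \prod_i extinct b M q L (l i)) l) [ffun=> 0%N]).
rewrite -nbinomD //.
apply: (@le_trans _ _ (nbinom q (k - M) (fun _ : profile b => 1) [ffun=> 0%N])).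
  by rewrite nbinom_const.
apply: (nbinom_le b_gt0 q_gt0 q_lt1 (D := setT)) => //.
- exact: bounded_const.
- exact: boundedD.
- move=> l _; rewrite -lerBlDl.
  have := prod_sub_ge (x := fun i => 1 - extinct b M q L (l i)) (fun i => s01 (l i)).
  by under [X in _ <= X -> _]eq_bigr => i _ do rewrite subKr.
Qed.

(** Let [th] be small. As long as the survival probability is at most [t * g] with
    [th <= t], it is also at most 1, hence at most [t * capped th^-1]; its next
    iterate is below [kappa * t * g] for a fixed [kappa < 1]. For the finitely many
    small types this is [capped_mean_contract], and for the others [g] exceeds
    [2 / th] and the trivial bound 1 suffices. Hence [t] decreases geometrically
    until it reaches [th]. *)
Lemma extinct_to1 K (e : R) : 0 < e -> exists L, 1 - e < extinct b M q L.+1 K.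
Proof.
move=> e0.
have eu := extinct_unit M b_gt0 q_gt0 q_lt1.
have s1 L k : 1 - extinct b M q L k <= 1.
  by have /andP[? ?] := eu L k; rewrite gerBl.
have dig k : (k <= M)%N -> extinct b M q 1 k = 1.
  move=> kM; rewrite /= (eqP kM : (k - M)%N = 0%N) /nbinom /=.
  by rewrite big1 // => i _; rewrite ffunE.
have [KM|MK] := leqP K M; first by exists 0%N; rewrite dig // gtrBl.
have gK : 0 < g K by apply: lt_le_trans (g_ge1 MK).
pose th : R := e / (2 * g K).
have th0 : 0 < th by rewrite divr_gt0 // mulr_gt0.
have [n gn] := g_unbounded (2 / th).
have thV0 : 0 <= th^-1 by rewrite invr_ge0 ltW.
have [kap /andP[kap0 kap1] contract] := capped_mean_contract n thV0.
pose kappa := Num.max kap 2^-1.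
have kappa0 : 0 < kappa by rewrite lt_max invr_gt0 ltr0n orbT.
have kappa1 : kappa < 1 by rewrite gt_max kap1 invf_lt1 // ltr1n.
have shrink L (t : R) : th <= t ->
    (forall k, 1 - extinct b M q L k <= t * g k) ->
    forall k, 1 - extinct b M q L.+1 k <= kappa * t * g k.
  move=> tht vt k; have t0 : 0 < t := lt_le_trans th0 tht.
  have [kn|nk] := leqP k n; last first.
    apply: le_trans (s1 _ _) _.
    have gk : g n <= g k by rewrite /g ler_nat leq_bin2l // ltnW.
    apply: le_trans (_ : 2^-1 * th * (2 / th) <= _).
      rewrite le_eqVlt; apply/orP; left; apply/eqP; field.
      by rewrite gt_eqF.
    have h0 : 0 <= 2^-1 :> R by rewrite invr_ge0.
    have h1 : 2^-1 * th <= kappa * t.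
      by apply: ler_pM => //; [exact: ltW|rewrite le_max lexx orbT].
    apply: ler_pM => //; first exact: mulr_ge0 h0 (ltW th0).
    - by rewrite divr_ge0 // ltW.
    - exact: le_trans (ltW gn) gk.
  apply: le_trans (survival_le_mean L k) _.
  have bc : bounded_nonneg (fun l : profile b => \sum_i capped th^-1 (l i)).
    by apply: bounded_sum => i; apply: (bounded_coord (C := th^-1)) => j; exact: capped_bound.
  apply: le_trans (_ : t * offspring_mean b M q (capped th^-1) k <= _).
    rewrite -[leRHS]/((fun l => t * nbinom q (k - M) (fun l : profile b =>
      \sum_i capped th^-1 (l i)) l) [ffun=> 0%N]) -nbinomZ ?(ltW t0) //.
    apply: (nbinom_le b_gt0 q_gt0 q_lt1 (D := setT)) => //.
    - apply: bounded_sum => i.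
      apply: (bounded_coord (v := fun k => 1 - extinct b M q L k) (C := 1)) => j.
      by rewrite s1 subr_ge0 andbT; have /andP[] := eu L j.
    - by apply: boundedZ => //; exact: ltW.
    - move=> l _; rewrite mulr_sumr; apply: ler_sum => i _.
      rewrite /capped minr_pMr ?(ltW t0) // le_min vt andbT.
      by apply: le_trans (s1 _ _) _; rewrite ler_pdivlMr // mul1r.
  rewrite [kappa * t]mulrC -mulrA ler_pM2l //.
  by apply: le_trans (contract _ kn) _; rewrite ler_wpM2r // le_max lexx.
have iter L : forall k,
    1 - extinct b M q L.+1 k <= Num.max th (kappa ^+ L) * g k.
  elim: L => [|L IH] k.
    have [kM|Mk] := leqP k M; first by rewrite dig // subrr g0 // mulr0.
    apply: le_trans (s1 _ _) _; apply: le_trans (g_ge1 Mk) _.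
    by rewrite expr0 ler_peMl // le_max lexx orbT.
  have := shrink _ _ _ IH k; rewrite le_max lexx => /(_ isT) h.
  apply: le_trans h _; rewrite ler_wpM2r // maxr_pMr ?(ltW kappa0) // ge_max.
  by rewrite exprS !le_max lexx orbT andbT ger_pMl // (ltW kappa1).
have [L hL] : exists L, kappa ^+ L <= th.
  have /cvgrPdist_lt/(_ th th0) : kappa ^+ n @[n --> \oo] --> (0 : R).
    by apply: cvg_expr; rewrite ger0_norm // ltW.
  move=> [N _ /(_ N (leqnn N))]; rewrite /= sub0r normrN => h.
  by exists N; apply: le_trans (ler_norm _) (ltW h).
exists L; have := iter L K; rewrite max_l // /th invfM mulrA divfK ?gt_eqF //.
lra.
Qed.

End critical.

(** * Real-valued probabilities *)
Section real_probability.
Context {d : measure_display} {T : measurableType d} {R : realType}.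
Context (P : probability T R).

(** Real values let linear arithmetic apply; all the sets in use are measurable. *)
Definition pr (A : set T) : R := fine (P A).

Lemma prE A : measurable A -> (pr A)%:E = P A.
Proof. by move=> mA; rewrite /pr fineK // fin_num_measure. Qed.

Lemma pr_ge0 A : 0 <= pr A.
Proof. by rewrite /pr fine_ge0. Qed.

Lemma pr_le A B : measurable A -> measurable B -> A `<=` B -> pr A <= pr B.
Proof.
by move=> mA mB AB; rewrite -lee_fin !prE //; apply: le_measure; rewrite ?inE.
Qed.

Lemma pr_setT : pr setT = 1.
Proof. by rewrite /pr probability_setT. Qed.

Lemma pr_set0 : pr set0 = 0.
Proof. by rewrite /pr measure0. Qed.

Lemma pr_le1 A : measurable A -> pr A <= 1.
Proof. by move=> mA; rewrite -pr_setT; exact: pr_le. Qed.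

Lemma pr_split A B : measurable A -> measurable B ->
  pr A = pr (A `\` B) + pr (A `&` B).
Proof.
move=> mA mB; apply: EFin_inj; rewrite EFinD !prE //.
- exact: measureDI.
- exact: measurableI.
- exact: measurableD.
Qed.

Lemma pr_setC A : measurable A -> pr (~` A) = 1 - pr A.
Proof.
move=> mA; rewrite -pr_setT (pr_split measurableT mA) setTI setTD.
by rewrite addrK.
Qed.

Lemma pr_bigcup_le (A : nat -> set T) (c : R) :
    (forall n, measurable (A n)) -> nondecreasing_seq A ->
    (forall n, pr (A n) <= c) ->
  pr (\bigcup_n A n) <= c.
Proof.
move=> mA ndA le; have mU := bigcupT_measurable _ mA.
have cv := nondecreasing_cvg_mu (mu := P) mA mU ndA.
rewrite -lee_fin prE // -(cvg_lim (@ereal_hausdorff R) cv).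
apply: lime_le; first by apply/cvg_ex; eexists; exact: cv.
by near=> n; rewrite /= -prE // lee_fin.
Unshelve. all: by end_near. Qed.

Lemma pr_finite_split (V : eqType) (f : T -> V) (A : set T) (s : seq V) :
    measurable A -> (forall z, measurable [set w | f w = z]) -> uniq s ->
  measurable (A `&` [set w | f w \notin s]) /\
  pr A = \sum_(z <- s) pr (A `&` [set w | f w = z]) +
         pr (A `&` [set w | f w \notin s]).
Proof.
move=> mA mf; elim: s => [_|z s IH /= /andP[zs us]].
  have -> : A `&` [set w | f w \notin [::]] = A by apply/seteqP; split => w //= [].
  by split=> //; rewrite big_nil add0r.
have [mR ->] := IH us; rewrite big_cons.
have rest : A `&` [set w | f w \notin z :: s] =
    (A `&` [set w | f w \notin s]) `\` [set w | f w = z].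
  apply/seteqP; split => w /=; rewrite inE negb_or.
    by move=> [Aw /andP[/eqP nz ns]].
  by move=> [[Aw ns] /eqP nz]; rewrite nz ns.
rewrite rest; split; first exact: measurableD.
rewrite (pr_split mR (mf z)).
have -> : A `&` [set w | f w \notin s] `&` [set w | f w = z] =
    A `&` [set w | f w = z].
  apply/seteqP; split => w /=; first by move=> [[]].
  by move=> [Aw fw]; rewrite fw.
by ring.
Qed.

End real_probability.

(** * The supermartingale inequality for the walk *)
Section process.
Context {d : measure_display} {T : measurableType d} {R : realType}.
Context (P : probability T R) (b M : nat) (q : R) (X : nat -> T -> vertex b).
Context (b_gt0 : (0 < b)%N) (q_gt0 : 0 < q) (q_lt1 : q < 1).
Context (hX : cookie_walk P (nseq_tuple M (0 : R)) q X).
Implicit Types (x y z : vertex b) (hs : seq (vertex b)) (o : option 'I_b).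

Fixpoint hist n w : seq (vertex b) :=
  if n is n'.+1 then X n w :: hist n' w else [:: X 0%N w].

Definition cylinder hs : set T := [set w | hist (size hs).-1 w = hs].

Lemma size_hist n w : size (hist n w) = n.+1.
Proof. by elim: n => //= n ->. Qed.

Lemma nth_hist n w k : (k <= n)%N -> nth (Defs.root b) (hist n w) k = X (n - k)%N w.
Proof.
elim: n k => [|n IH] [|k] //= kn; by rewrite IH // subSS.
Qed.

Lemma measurable_X n (A : set (vertex b)) : measurable (X n @^-1` A).
Proof. by case: hX => h _ _; exact: h. Qed.

Lemma measurable_hist n (A : set (seq (vertex b))) :
  measurable [set w | A (hist n w)].
Proof.
elim: n A => [|n IH] A; first exact: (measurable_X 0 [set x | A [:: x]]).
have -> : [set w | A (hist n.+1 w)] = \bigcup_(x in [set: seq 'I_b])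
    ((X n.+1 @^-1` [set x]) `&` [set w | A ((x : vertex b) :: hist n w)]).
  apply/seteqP; split => w /=; first by move=> Aw; exists (X n.+1 w).
  by move=> [x _ /= [-> ]].
apply: countable_bigcupT_measurable; first exact: countableP.
by move=> x; apply: measurableI; [exact: measurable_X|exact: (IH [set s | A (x :: s)])].
Qed.

Lemma measurable_cylinder hs : measurable (cylinder hs).
Proof. exact: (measurable_hist _ [set s | s = hs]). Qed.

Lemma cylinder_cons hs z : hs != [::] ->
  cylinder (z :: hs) = [set w | X (size hs) w = z] `&` cylinder hs.
Proof.
case: hs => [//|x hs] _; rewrite /cylinder /=.
by apply/seteqP; split => w /=; [case=> -> ->|move=> [-> ->]].
Qed.

Lemma cylinder_history hs : hs != [::] ->
  cylinder hs = history X (size hs).-1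
    (fun k => nth (Defs.root b) hs ((size hs).-1 - k)).
Proof.
move=> hs0; have : size hs = (size hs).-1.+1 by case: hs hs0.
rewrite /cylinder; move: (size hs).-1 => n sz.
apply/seteqP; split => w; rewrite /history /=.
  by move=> <- k kn; rewrite nth_hist ?leq_subr // subKn.
move=> h; apply: (@eq_from_nth _ (Defs.root b)); rewrite size_hist //.
by move=> k; rewrite ltnS => kn; rewrite nth_hist // h ?leq_subr // subKn.
Qed.

Lemma nvisits_past hs : hs != [::] ->
  nvisits (fun k => nth (Defs.root b) hs ((size hs).-1 - k)) (size hs).-1 =
  (past hs (cur hs)).+1.
Proof.
case: hs => [//|x hs] _; rewrite /past /cur /= /nvisits subnn /=.
have -> : (count_mem x hs).+1 = count_mem x (x :: hs) by rewrite /= eqxx.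
rewrite -sum1_card -sum1_count [RHS](big_nth (Defs.root b)) big_mkord.
rewrite (reindex_inj rev_ord_inj) /=; apply: eq_bigl => i.
by rewrite inE /= subSS subKn // -ltnS.
Qed.

Lemma strength_dig j : strength (nseq_tuple M (0 : R)) q j.+1 =
  if (j < M)%N then 0 else q.
Proof. by rewrite /strength /= nth_nseq. Qed.


Lemma cylinder_step hs o : hs != [::] -> 0 < pr P (cylinder hs) ->
  pr P (cylinder (move (cur hs) o :: hs)) = move_prob M q hs o * pr P (cylinder hs).
Proof.
move=> hs0 pos; have sz : size hs = (size hs).-1.+1 by case: hs hs0 {pos}.
have Ppos : (0 < P (history X (size hs).-1
    (fun k => nth (Defs.root b) hs ((size hs).-1 - k))))%E.
  by rewrite -cylinder_history // -prE ?lte_fin //; exact: measurable_cylinder.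
have [_ _ /(_ _ _ Ppos)] := hX.
rewrite nvisits_past // strength_dig -/(bias M q hs) -cylinder_history // -sz.
have -> : nth (Defs.root b) hs ((size hs).-1 - (size hs).-1) = cur hs.
  by rewrite subnn nth0.
rewrite cylinder_cons // => -[hson hfather].
have eq z c : cond_prob P [set w | X (size hs) w = z] (cylinder hs) = c ->
    pr P ([set w | X (size hs) w = z] `&` cylinder hs) = c * pr P (cylinder hs).
  by rewrite /cond_prob => <-; rewrite divfK // gt_eqF.
by case: o => [i|]; apply: eq; [exact: hson|exact: hfather].
Qed.

Lemma cylinder_root : pr P (cylinder [:: Defs.root b]) = 1.
Proof.
have [_ h _] := hX; rewrite /pr /cylinder /=.
have -> : [set w | [:: X 0%N w] = [:: Defs.root b]] = [set w | X 0%N w = Defs.root b].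
  by apply/seteqP; split => w /=; [case|move=> ->].
by rewrite h.
Qed.

Lemma move_prob_ge0 hs o : 0 <= move_prob M q hs o.
Proof.
rewrite /move_prob /bias; case: o => [i|]; case: ifP => _.
- by rewrite mul0r.
- by rewrite divr_ge0 // ltW.
- by rewrite subr0.
- by rewrite subr_ge0 ltW.
Qed.

(** The step probabilities sum to 1, so the walk almost surely makes one of the
    steps encoded by [option 'I_b]. *)
Lemma cylinder_split hs (B : set T) : hs != [::] -> 0 < pr P (cylinder hs) ->
    measurable B ->
  pr P (cylinder hs `&` B) <= \sum_(o <- None :: [seq Some i | i <- enum 'I_b])
    pr P (cylinder (move (cur hs) o :: hs) `&` B).
Proof.
move=> hs0 pos mB.
pose os : seq (option 'I_b) := None :: [seq Some i | i <- enum 'I_b].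
have uos : uniq os.
  rewrite /= map_inj_uniq ?enum_uniq ?andbT; last by move=> i j [].
  by apply/negP => /mapP[].
pose s := [seq move (cur hs) o | o <- os].
have us : uniq s by rewrite map_inj_uniq //; exact: move_inj.
have mX z : measurable [set w | X (size hs) w = z].
  exact: (measurable_X (size hs) [set z]).
have mC := measurable_cylinder hs.
have [mR eC] := pr_finite_split P mC mX us.
have mCB : measurable (cylinder hs `&` B) by exact: measurableI.
have [mRB eCB] := pr_finite_split P mCB mX us.
have cons z : cylinder hs `&` [set w | X (size hs) w = z] = cylinder (z :: hs).
  by rewrite cylinder_cons // setIC.
have rest : pr P (cylinder hs `&` [set w | X (size hs) w \notin s]) = 0.
  have : \sum_(z <- s) pr P (cylinder hs `&` [set w | X (size hs) w = z]) =
      pr P (cylinder hs).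
    rewrite big_map (eq_bigr (fun o => move_prob M q hs o * pr P (cylinder hs))).
      rewrite -mulr_suml big_cons big_map big_enum /= sumr_const card_ord.
      rewrite -[_ *+ b]mulr_natr divfK ?pnatr_eq0 -?lt0n //.
      by rewrite subrK mul1r.
    by move=> o _; rewrite cons cylinder_step.
  by move: eC => /[swap] ->; lra.
have restB : pr P (cylinder hs `&` B `&` [set w | X (size hs) w \notin s]) = 0.
  apply/le_anti/andP; split; last exact: pr_ge0.
  by rewrite -rest; apply: pr_le => // w [[]].
rewrite eCB restB addr0 big_map; apply: ler_sum => o _.
apply: pr_le; first by apply: measurableI.
  by apply: measurableI => //; exact: measurable_cylinder.
by rewrite -cons => w [[? ?] ?].
Qed.

(** Optional stopping at a fixed time, in the form of a bound on the probability of
    an event decided by time [n]. By induction on the remaining time, the bound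
    holds conditionally on every history of positive probability. *)
Lemma supermartingale_bound n (B : set (seq (vertex b)))
    (U : seq (vertex b) -> R) :
    (forall hs, valid M q hs -> 0 <= U hs) ->
    (forall hs, valid M q hs -> (size hs <= n)%N ->
      step_mean (bias M q hs) (fun o => U (move (cur hs) o :: hs)) <= U hs) ->
    (forall hs, valid M q hs -> size hs = n.+1 -> B hs -> 1 <= U hs) ->
  pr P [set w | B (hist n w)] <= U [:: Defs.root b].
Proof.
move=> U0 super U1.
set E := [set w | B (hist n w)]; have mE : measurable E := measurable_hist n B.
have key k hs : valid M q hs -> (size hs + k = n.+1)%N ->
    pr P (cylinder hs `&` E) <= U hs * pr P (cylinder hs).
  elim: k hs => [|k IH] hs vhs sz.
    rewrite addn0 in sz.
    have [Bhs|nB] := pselect (B hs).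
      apply: (@le_trans _ _ (pr P (cylinder hs))); last first.
        by rewrite ler_peMl ?pr_ge0 //; exact: U1.
      by apply: pr_le => //; [apply: measurableI => //|]; exact: measurable_cylinder.
    have -> : cylinder hs `&` E = set0.
      apply/seteqP; split => w //=; rewrite /cylinder /E /= sz /= => -[eq].
      by rewrite eq.
    by rewrite pr_set0 mulr_ge0 ?pr_ge0 ?U0.
  have hs0 := valid_neq0 vhs; have mC := measurable_cylinder hs.
  have [pos|npos] := ltP 0 (pr P (cylinder hs)); last first.
    apply: (@le_trans _ _ (pr P (cylinder hs))).
      by apply: pr_le => //; apply: measurableI.
    by apply: le_trans npos _; rewrite mulr_ge0 ?pr_ge0 ?U0.
  apply: le_trans (cylinder_split hs0 pos mE) _.
  apply: (@le_trans _ _ (\sum_(o <- None :: [seq Some i | i <- enum 'I_b])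
      move_prob M q hs o * U (move (cur hs) o :: hs) * pr P (cylinder hs))).
    apply: ler_sum => o _.
    have mCo := measurable_cylinder (move (cur hs) o :: hs).
    have [mp|mp] := ltP 0 (move_prob M q hs o).
      rewrite mulrAC -cylinder_step // [leRHS]mulrC.
      by apply: IH; [exact: valid_move|rewrite /= -sz addSnnS].
    have mp0 : move_prob M q hs o = 0.
      by apply/le_anti; rewrite mp move_prob_ge0.
    rewrite mp0 !mul0r.
    apply: (@le_trans _ _ (pr P (cylinder (move (cur hs) o :: hs)))).
      by apply: pr_le => //; apply: measurableI.
    by rewrite cylinder_step // mp0 mul0r.
  rewrite -mulr_suml ler_pM2r // big_cons big_map big_enum /= -mulr_sumr.
  by apply: super => //; rewrite -ltnS -sz; lia.
have mC := measurable_cylinder [:: Defs.root b].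
have := key n [:: Defs.root b] (valid_root _ _) (erefl _).
rewrite cylinder_root mulr1; apply: le_trans.
rewrite (pr_split P mE mC) setIC.
have : pr P (E `\` cylinder [:: Defs.root b]) <= 0.
  apply: (@le_trans _ _ (pr P (~` cylinder [:: Defs.root b]))).
    apply: pr_le; [exact: measurableD|exact: measurableC|by move=> w []].
  by rewrite pr_setC // cylinder_root subrr.
lra.
Qed.

End process.

(** * Repeated trials *)
Section digging_walk.
Context {d : measure_display} {T : measurableType d} {R : realType}.
Context (P : probability T R) (b M : nat) (q : R) (X : nat -> T -> vertex b).
Context (b_gt0 : (0 < b)%N) (q_gt0 : 0 < q) (q_lt1 : q < 1).
Context (hX : cookie_walk P (nseq_tuple M (0 : R)) q X).
Implicit Types (x y z : vertex b) (hs : seq (vertex b)) (o : option 'I_b).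

Lemma step_mean_le hs (F G : option 'I_b -> R) :
    (forall o, 0 < move_prob M q hs o -> F o <= G o) ->
  step_mean (bias M q hs) F <= step_mean (bias M q hs) G.
Proof.
move=> le; have h o : move_prob M q hs o * F o <= move_prob M q hs o * G o.
  have := move_prob_ge0 M q_gt0 q_lt1 hs o.
  by rewrite le0r => /orP[/eqP ->|pos]; rewrite ?mul0r // ler_pM2l // le.
rewrite /step_mean; apply: lerD; first exact: h None.
by rewrite !mulr_sumr; apply: ler_sum => i _; exact: h (Some i).
Qed.

Lemma step_mean_eq (s : R) o (u v : R) :
  step_mean s (fun o' => if o' == o then u else v) =
  v + (if o is Some _ then s / b%:R else 1 - s) * (u - v) :> R.
Proof.
have b0 : (b%:R : R) != 0 by rewrite pnatr_eq0 -lt0n.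
rewrite /step_mean; case: o => [i|] /=; last first.
  rewrite sumr_const card_ord -[v *+ b]mulr_natl; field; exact: b0.
rewrite (bigD1 i) //= eqxx (eq_bigr (fun=> v)); last first.
  by move=> j /negbTE ji; rewrite (inj_eq Some_inj) ji.
rewrite sumr_const (cardC1 i) card_ord -[v *+ b.-1]mulr_natl.
by rewrite -subn1 natrB //; field; exact: b0.
Qed.

Definition visits_unbounded x : set T :=
  [set w | forall k, exists n, (k <= past (hist X n w) x)%N].

Definition moves_unbounded x o : set T :=
  [set w | forall k, exists n, (k <= moves (hist X n w) x o)%N].

Lemma measurable_unbounded (f : seq (vertex b) -> nat) :
  measurable [set w | forall k, exists n, (k <= f (hist X n w))%N].
Proof.
have -> : [set w | forall k, exists n, (k <= f (hist X n w))%N] =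
    \bigcap_k \bigcup_n [set w | (k <= f (hist X n w))%N].
  apply/seteqP; split => w /=.
    by move=> h k _; have [n kn] := h k; exists n.
  by move=> h k; have [n _ kn] := h k I; exists n.
apply: bigcapT_measurable => k; apply: bigcupT_measurable => n.
exact: (measurable_hist hX n [set hs | (k <= f hs)%N]).
Qed.

Lemma past_hist_nd x w : {homo (fun n => past (hist X n w) x) : m n / (m <= n)%N}.
Proof.
apply: homo_leq => //; first exact: leq_trans.
by move=> n; rewrite /= past_cons ?leq_addl //; case: n.
Qed.

Lemma moves_hist_nd x o w :
  {homo (fun n => moves (hist X n w) x o) : m n / (m <= n)%N}.
Proof.
apply: homo_leq => //; first exact: leq_trans.
by move=> n; rewrite /= leq_addr.
Qed.

(** Each visit to [x] is a trial that produces the step [o] with probability at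
    least [e]. With [f] the number of such steps, [th f = 1 - a ^+ (j.+1 - f)]
    vanishes beyond [j] and is contracted in the mean by a factor [rho] at every
    trial, where [a = e / 2]; rescaling it by [rho] to the power of minus the number
    of trials gives a supermartingale. *)
Lemma moves_few_bound x o (e : R) (j k n : nat) : 0 < e <= 1 ->
    (forall hs, cur hs = x -> (M <= past hs x)%N -> e <= move_prob M q hs o) ->
  pr P [set w | (k + M <= past (hist X n w) x)%N && (moves (hist X n w) x o <= j)%N]
  <= 2 * (1 - (e / 2) ^+ j.+1) ^+ k.
Proof.
move=> /andP[e0 e1] often.
set a := e / 2; have a0 : 0 < a by rewrite divr_gt0.
have a1 : 2 * a <= 1 by rewrite /a mulrC divfK.
have aj0 : 0 < a ^+ j.+1 by rewrite exprn_gt0.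
have aj1 : a ^+ j.+1 < 1 by rewrite exprn_ilt1 ?(ltW a0) //; lra.
set rho := 1 - a ^+ j.+1.
have rho0 : 0 < rho by rewrite subr_gt0.
have rho1 : rho <= 1 by rewrite gerBl ltW.
pose th f : R := 1 - a ^+ (j.+1 - f).
have th0 f : 0 <= th f.
  by rewrite subr_ge0 exprn_ile1 ?(ltW a0) //; lra.
have thS f : th f.+1 <= th f.
  by rewrite lerD2l lerN2 ler_wiXn2l ?(ltW a0) ?leq_sub2l //; lra.
pose U hs : R := 2 * rho ^+ k / rho ^+ (past hs x - M) * th (moves hs x o).
have c0 hs : 0 <= 2 * rho ^+ k / rho ^+ (past hs x - M).
  by rewrite divr_ge0 ?mulr_ge0 ?exprn_ge0 ?(ltW rho0).
apply: le_trans (supermartingale_bound b_gt0 q_gt0 q_lt1 hX (n := n)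
  (B := [set hs | (k + M <= past hs x)%N && (moves hs x o <= j)%N]) (U := U) _ _ _) _.
- by move=> hs _; rewrite mulr_ge0.
- move=> hs vhs _; have hs0 := valid_neq0 vhs.
  have [cx|cx] := eqVneq (cur hs) x; last first.
    have UE o' : U (move (cur hs) o' :: hs) = U hs.
      by rewrite /U past_cons // moves_cons // (negbTE cx) addn0 add0n.
    rewrite -[leRHS](step_mean_const b_gt0 (bias M q hs)); apply: step_mean_le => o' _.
    by rewrite UE.
  have UE o' : U (move (cur hs) o' :: hs) =
      2 * rho ^+ k / rho ^+ ((past hs x).+1 - M) *
      th (moves hs x o + (o' == o))%N.
    by rewrite /U past_cons // moves_cons // cx eqxx add1n /= eq_sym.
  have [early|late] := ltnP (past hs x) M.
    rewrite -[leRHS](step_mean_const b_gt0 (bias M q hs)); apply: step_mean_le => o' _.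
    rewrite UE /U (_ : (_.+1 - M = past hs x - M)%N); last by lia.
    by apply: ler_wpM2l => //; case: (o' == o); rewrite ?addn0 ?addn1.
  have e_le := often _ cx late.
  set f := moves hs x o in UE *.
  pose c := 2 * rho ^+ k / rho ^+ ((past hs x).+1 - M).
  have cE : 2 * rho ^+ k / rho ^+ (past hs x - M) = c * rho.
    rewrite /c subSn // exprS; field.
    by rewrite expf_neq0 /= gt_eqF.
  have cc0 : 0 <= c by rewrite /c divr_ge0 ?mulr_ge0 ?exprn_ge0 ?(ltW rho0).
  apply: (@le_trans _ _ (step_mean (bias M q hs)
      (fun o' => if o' == o then c * th f.+1 else c * th f))).
    apply: step_mean_le => o' _; rewrite UE -/c.
    by case: (o' == o); rewrite ?addn0 ?addn1.
  rewrite step_mean_eq /U cE -/f -/(move_prob M q hs o).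
  have -> : c * th f + move_prob M q hs o * (c * th f.+1 - c * th f) =
    c * (th f + move_prob M q hs o * (th f.+1 - th f)) by ring.
  rewrite -mulrA; apply: ler_wpM2l => //.
  have [jf|fj] := ltnP j f.
    have z f' : (j < f')%N -> th f' = 0.
      by move=> jf'; rewrite /th (eqP (_ : (j.+1 - f' == 0)%N)) ?subn_eq0 // expr0 subrr.
    by rewrite !z // ?mulr0 ?subrr ?mulr0 ?addr0 // ltnS ltnW.
  have thE : th f = 1 - a * a ^+ (j - f) by rewrite /th subSn // exprS.
  have thE' : th f.+1 = 1 - a ^+ (j - f) by rewrite /th subSS.
  apply: (@le_trans _ _ (th f + e * (th f.+1 - th f))).
    by rewrite lerD2l; apply: ler_wnM2r => //; rewrite subr_le0.
  have ar : a ^+ j.+1 <= a * a ^+ (j - f).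
    by rewrite -exprS ler_wiXn2l ?(ltW a0) //; [lra|rewrite -subSn // leq_subr].
  rewrite /rho thE thE'; have -> : e = 2 * a by rewrite /a mulrC divfK.
  set A := a ^+ (j - f) in ar *; set B := a ^+ j.+1 in ar aj0 *.
  have A0 : 0 < A by rewrite exprn_gt0.
  rewrite -subr_ge0.
  have -> : (1 - B) * (1 - a * A) -
      (1 - a * A + 2 * a * (1 - A - (1 - a * A))) =
      (a * A - B) + B * (a * A) + a * A * (1 - 2 * a) by ring.
  have aA0 : 0 <= a * A := mulr_ge0 (ltW a0) (ltW A0).
  have t1 : 0 <= a * A - B by rewrite subr_ge0.
  have t2 : 0 <= B * (a * A) := mulr_ge0 (ltW aj0) aA0.
  have t3 : 0 <= a * A * (1 - 2 * a) by apply: mulr_ge0 => //; rewrite subr_ge0.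
  by rewrite addr_ge0 // addr_ge0.
- move=> hs _ _ /= /andP[kp mj]; rewrite /U.
  apply: (@le_trans _ _ (2 * 2^-1)); first by rewrite mulfV.
  rewrite -2!mulrA; apply: ler_wpM2l => //; rewrite mulrA.
  rewrite -[leLHS]mul1r; apply: ler_pM => //.
    rewrite ler_pdivlMr ?exprn_gt0 // mul1r ler_wiXn2l ?(ltW rho0) //.
    by lia.
  rewrite /th lerBrDl -lerBrDr subSn // exprS.
  have : a ^+ (j - moves hs x o) <= 1 by rewrite exprn_ile1 ?(ltW a0) //; lra.
  set A := a ^+ _ => A1.
  apply: (@le_trans _ _ a); first by rewrite ler_piMr // ltW.
  by rewrite /a; lra.
- rewrite /U /past /= sub0n expr0 divr1 -[leRHS]mulr1; apply: ler_wpM2l.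
    by rewrite mulr_ge0 // exprn_ge0 // ltW.
  by rewrite /th gerBl exprn_ge0 // ltW.
Qed.

End digging_walk.

(** * From visits to steps, and the extinction martingale along the walk *)
Section recurrence_criterion.
Context {d : measure_display} {T : measurableType d} {R : realType}.
Context (P : probability T R) (b M : nat) (q : R) (X : nat -> T -> vertex b).
Context (b_gt0 : (0 < b)%N) (q_gt0 : 0 < q) (q_lt1 : q < 1).
Context (hX : cookie_walk P (nseq_tuple M (0 : R)) q X).
Implicit Types (x y z : vertex b) (hs : seq (vertex b)) (o : option 'I_b).

Lemma expr_small (c rho e : R) : 0 < c -> 0 <= rho < 1 -> 0 < e ->
  exists n, c * rho ^+ n < e.
Proof.
move=> c0 /andP[r0 r1] e0.
have /cvgrPdist_lt/(_ (e / c) (divr_gt0 e0 c0)) : rho ^+ n @[n --> \oo] --> (0 : R).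
  by apply: cvg_expr; rewrite ger0_norm.
move=> [N _ /(_ N (leqnn N))]; rewrite /= sub0r normrN => h.
by exists N; rewrite mulrC -ltr_pdivlMr //; apply: le_lt_trans (ler_norm _) h.
Qed.

(** A conditional Borel--Cantelli statement: almost surely, infinitely many visits
    to [x] yield infinitely many steps [o]. *)
Lemma visits_le_moves x o (e : R) : 0 < e <= 1 ->
    (forall hs, cur hs = x -> (M <= past hs x)%N -> e <= move_prob M q hs o) ->
  pr P (visits_unbounded X x) <= pr P (moves_unbounded X x o).
Proof.
move=> e01 often.
have mV := measurable_unbounded hX (past^~ x).
have mJ := measurable_unbounded hX (fun hs => moves hs x o).
rewrite (pr_split P mV mJ).
have mI : measurable (visits_unbounded X x `&` moves_unbounded X x o).
  exact: measurableI.
have le2 : pr P (visits_unbounded X x `&` moves_unbounded X x o) <=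
    pr P (moves_unbounded X x o) by apply: pr_le => // w [].
have mfew j n : measurable [set w | (moves (hist X n w) x o <= j)%N].
  exact: (measurable_hist hX n [set hs | (moves hs x o <= j)%N]).
have mpast j n : measurable [set w | (j <= past (hist X n w) x)%N].
  exact: (measurable_hist hX n [set hs | (j <= past hs x)%N]).
pose few j := \bigcap_n [set w | (moves (hist X n w) x o <= j)%N].
have mF j : measurable (few j) by apply: bigcapT_measurable => n.
(* Up to any time, k visits with at most j steps have probability O(rho ^ k),
   uniformly in time. *)
have null j : pr P (visits_unbounded X x `&` few j) = 0.
  apply/le_anti; rewrite pr_ge0 andbT; apply/ler_addgt0Pr => c c0; rewrite add0r.
  set rho := 1 - (e / 2) ^+ j.+1.
  have rho01 : 0 <= rho < 1.
    have /andP[e0 e1] := e01.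
    have a0 : 0 < e / 2 by rewrite divr_gt0.
    have a1 : e / 2 <= 1 by lra.
    by rewrite /rho subr_ge0 exprn_ile1 ?(ltW a0) //= gtrBl exprn_gt0.
  have [k kc] := expr_small (ltr0n R 2) rho01 c0.
  apply: le_trans (ltW kc).
  pose A n := [set w | (k + M <= past (hist X n w) x)%N] `&` few j.
  have mA n : measurable (A n) by apply: measurableI.
  apply: (@le_trans _ _ (pr P (\bigcup_n A n))).
    apply: pr_le; [exact: measurableI|exact: bigcupT_measurable|].
    by move=> w [/(_ (k + M)%N)[n kn] fw]; exists n.
  apply: pr_bigcup_le => //.
    move=> m n mn; apply/subsetPset => w [/= km fw]; split=> //=.
    exact: leq_trans km (past_hist_nd X x w mn).
  move=> n; apply: le_trans (moves_few_bound b_gt0 q_gt0 q_lt1 hX j k n e01 often).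
  apply: pr_le => //.
    exact: (measurable_hist hX n [set hs | (k + M <= past hs x)%N && (moves hs x o <= j)%N]).
  by move=> w [/= -> /(_ n I) /= ->].
suff : pr P (visits_unbounded X x `\` moves_unbounded X x o) <= 0 by lra.
apply: (@le_trans _ _ (pr P (\bigcup_j (visits_unbounded X x `&` few j)))).
  apply: pr_le; [exact: measurableD| |].
    by apply: bigcupT_measurable => j; exact: measurableI.
  move=> w [Vw /existsNP[j Jw]]; exists j => //; split=> // n _ /=.
  by rewrite leqNgt; apply/negP => h; apply: Jw; exists n; exact: ltnW.
apply: pr_bigcup_le => [j|m n mn|j]; first exact: measurableI.
- apply/subsetPset => w [Vw fw]; split=> // i _; apply: leq_trans mn; exact: fw.
- by rewrite null.
Qed.

Lemma walk_step L K hs : valid M q hs -> all (fun y => (size y < L)%N) hs ->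
    (moves hs (Defs.root b) None < K)%N ->
  step_mean (bias M q hs) (fun o =>
    cond_extinct M q L (moves (move (cur hs) o :: hs)) (Defs.root b) K) =
  cond_extinct M q L (moves hs) (Defs.root b) K.
Proof.
move=> vhs low fK; have hs0 := valid_neq0 vhs.
have stepE o : moves (move (cur hs) o :: hs) = add_move (moves hs) (cur hs) o.
  by apply/funext => y; apply/funext => o'; rewrite moves_cons.
rewrite /step_mean stepE; under eq_bigr do rewrite stepE.
apply: cond_extinct_step => //.
- exact: suffix0s.
- by case: hs hs0 low {vhs fK stepE} => //= x hs _ /andP[].
- by move=> i z iz; rewrite (valid_flow vhs) iz addn1.
- rewrite /bias; case: ltnP => h; [left|right]; split=> //.
    exact: leq_ltn_trans (moves_le_past _ _ _) h.
  by have := valid_digging vhs (cur hs); rewrite (minn_idPr h).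
Qed.

(** At a time when the walk is at the root, all entrances have been matched. *)
Lemma walk_complete L hs : (0 < L)%N -> valid M q hs ->
    all (fun y => (size y < L)%N) hs -> cur hs = Defs.root b ->
  cond_extinct M q L (moves hs) (Defs.root b) (moves hs (Defs.root b) None) = 1.
Proof.
move=> L0 vhs low cr; apply: (cond_extinct_complete _ _ L0) => //.
  by move=> i z; rewrite (valid_flow vhs) cr suffixs0 addn0.
move=> i z iz; apply/eqP; rewrite eqn0Ngt; apply/negP => /moves_mem /(allP low).
by rewrite -iz ltnn.
Qed.

Lemma walk_reached L K hs : valid M q hs -> (0 < L)%N ->
    ~~ all (fun y => (size y < L)%N) hs ->
  cond_extinct M q L (moves hs) (Defs.root b) K = 0.
Proof.
move=> vhs L0 high.
have [i [z [zL pos]]] : exists i z, (size z + 1 = L)%N /\ (0 < moves hs z (Some i))%N.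
  elim: vhs high => [|{}hs o vhs IH _]; first by rewrite /= L0.
  have hs0 := valid_neq0 vhs.
  have [low|/IH[i [z [zL pos]]]] := boolP (all (fun y => (size y < L)%N) hs).
    rewrite /= low andbT -leqNgt.
    have : (size (cur hs) < L)%N by case: hs hs0 low {vhs IH} => //= x hs _ /andP[].
    case: o => [i|] /= h2 h1.
      exists i, (cur hs); split; first by apply/eqP; rewrite addn1 eqn_leq h2.
      by rewrite hs0 eqxx /= eqxx addn1.
    by have := leq_trans h2 h1; rewrite /father size_behead; move: (size _) => s; lia.
  by exists i, z; split=> //=; rewrite addn_gt0 pos.
by apply: (cond_extinct_reached M b_gt0 q_gt0 q_lt1 K _ _ pos); [exact: suffix0s|exact: zL].
Qed.

End recurrence_criterion.

(** * Bounces at the root *)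
Section root_returns.
Context {d : measure_display} {T : measurableType d} {R : realType}.
Context (P : probability T R) (b M : nat) (q : R) (X : nat -> T -> vertex b).
Context (b_gt0 : (0 < b)%N) (q_gt0 : 0 < q) (q_lt1 : q < 1).
Context (hX : cookie_walk P (nseq_tuple M (0 : R)) q X).
Implicit Types (x y z : vertex b) (hs : seq (vertex b)) (o : option 'I_b).

Local Notation low L := (all (fun y : vertex b => (size y < L)%N)).
Local Notation bounces hs := (moves hs (Defs.root b) None).

Let cond_unit L hs K :
  0 <= cond_extinct M q L (moves hs) (Defs.root b) K <= 1.
Proof. exact: cond_extinct_unit. Qed.

Let eq_ler (u v : R) : u = v -> u <= v.
Proof. by move=> ->. Qed.

(** A bounce is a step from the root to itself. It plays the part of a return to
    the father for the root, so the numbers of jumps made before the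
    [K]-th bounce are a branching process started from [K]. *)
Lemma bounces_cons hs o : hs != [::] ->
  bounces (move (cur hs) o :: hs) =
  (bounces hs + ((cur hs == Defs.root b) && (o == None)))%N.
Proof. by move=> hs0; rewrite moves_cons. Qed.

(** The walk cannot stay for ever below depth [L] without bouncing [K] times: a step
    to the father always has probability at least [1 - q]. The number [r] of such
    steps still needed is the depth plus the missing bounces, and
    [1 - a ^+ r] is contracted in the mean when [a = (1 - q) / 2]. *)
Lemma confined_bound L K n : (0 < K)%N ->
  pr P [set w | (bounces (hist X n w) < K)%N && low L (hist X n w)] <=
  2 * (1 - ((1 - q) / 2) ^+ (L + K)) ^+ n.
Proof.
move=> K0; set a := (1 - q) / 2.
have a0 : 0 < a by rewrite divr_gt0 // subr_gt0.
have a2 : 2 * a = 1 - q by rewrite /a mulrC divfK.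
have a1 : a <= 2^-1.
  by rewrite -(ler_pM2l (ltr0n R 2)) a2 mulfV // gerBl ltW.
have a1' : a <= 1 by apply: le_trans a1 _; rewrite invf_le1 ?ler1n.
have aV : a < 1 by apply: le_lt_trans a1 _; rewrite invf_lt1 ?ltr1n.
set rho := 1 - a ^+ (L + K).
have rho0 : 0 < rho by rewrite subr_gt0 exprn_ilt1 ?(ltW a0) // -lt0n addn_gt0 K0 orbT.
have an1 k : a ^+ k <= 1 by rewrite exprn_ile1 ?(ltW a0).
pose phi hs : R := if (bounces hs < K)%N && low L hs
  then 1 - a ^+ (size (cur hs) + (K - bounces hs)) else 0.
have phi0 hs : 0 <= phi hs by rewrite /phi; case: ifP => _ //; rewrite subr_ge0.
have phi1 hs : phi hs <= 1.
  by rewrite /phi; case: ifP => _ //; rewrite gerBl exprn_ge0 // ltW.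
pose U hs := 2 * rho ^+ (n.+1 - size hs) * phi hs.
apply: le_trans (supermartingale_bound b_gt0 q_gt0 q_lt1 hX (n := n)
  (B := [set hs | (bounces hs < K)%N && low L hs]) (U := U) _ _ _) _.
- by move=> hs _; rewrite /U !mulr_ge0 // exprn_ge0 // ltW.
- move=> hs vhs hsn; have hs0 := valid_neq0 vhs.
  pose c := 2 * rho ^+ (n - size hs).
  have c0 : 0 <= c by rewrite mulr_ge0 // exprn_ge0 // ltW.
  have UE o : U (move (cur hs) o :: hs) = c * phi (move (cur hs) o :: hs).
    by rewrite /U /= subSS.
  have UhsE : U hs = c * (rho * phi hs).
    by rewrite /U /c subSn // exprS; ring.
  apply: (@le_trans _ _ (c * step_mean (bias M q hs)
      (fun o => phi (move (cur hs) o :: hs)))).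
    rewrite /step_mean UE; under eq_bigr do rewrite UE.
    by rewrite -mulr_sumr; apply: eq_ler; ring.
  rewrite UhsE; apply: ler_wpM2l => //.
  have [act|stop] := boolP ((bounces hs < K)%N && low L hs); last first.
    have -> : phi hs = 0 by rewrite /phi (negbTE stop).
    rewrite mulr0 -[leRHS](step_mean_const b_gt0 (bias M q hs)).
    apply: (step_mean_le q_gt0 q_lt1) => o _.
    rewrite /phi bounces_cons //; case: ifP => // /andP[f1 /= /andP[_ l1]].
    by case/negP: stop; rewrite l1 andbT (leq_ltn_trans (leq_addr _ _) f1).
  have /andP[fK lowhs] := act.
  set r := (size (cur hs) + (K - bounces hs))%N.
  have r0 : (0 < r)%N by rewrite addn_gt0 subn_gt0 fK orbT.
  have rLK : (r <= L + K)%N.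
    apply: leq_add; last exact: leq_subr.
    by apply: ltnW; case: (hs) hs0 lowhs => //= x s _ /andP[].
  apply: (@le_trans _ _ (step_mean (bias M q hs)
      (fun o => if o == None then 1 - a ^+ r.-1 else 1))).
    apply: (step_mean_le q_gt0 q_lt1) => -[i|] _; first exact: phi1.
    rewrite /phi bounces_cons // eqxx andbT; case: ifP => _; last by rewrite subr_ge0.
    rewrite lerD2l lerN2 ler_wiXn2l ?(ltW a0) //=.
    rewrite /father size_behead /r.
    case: eqVneq => [->|nr] /=; first lia.
    have : size (cur hs) != 0%N by apply: contra nr; rewrite size_eq0.
    by move: (size (cur hs)) => s; lia.
  rewrite (step_mean_eq b_gt0) /phi act -/r.
  have sq : 1 - q <= 1 - bias M q hs.
    by rewrite lerD2l lerN2 /bias; case: ifP => _ //; exact: ltW.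
  have -> : 1 + (1 - bias M q hs) * (1 - a ^+ r.-1 - 1) =
    1 - (1 - bias M q hs) * a ^+ r.-1 by ring.
  apply: (@le_trans _ _ (1 - 2 * a ^+ r)).
    rewrite lerD2l lerN2 -{1}(prednK r0) exprS mulrA a2.
    by apply: ler_wpM2r sq; rewrite exprn_ge0 // ltW.
  have ar : a ^+ (L + K) <= a ^+ r by rewrite ler_wiXn2l ?(ltW a0).
  have ar0 : 0 <= a ^+ (L + K) by rewrite exprn_ge0 // ltW.
  have := mulr_ge0 ar0 (exprn_ge0 r (ltW a0)).
  rewrite /rho; move: (a ^+ (L + K)) (a ^+ r) ar => A B AB AB0.
  rewrite -subr_ge0.
  have -> : (1 - A) * (1 - B) - (1 - 2 * B) = (B - A) + A * B by ring.
  by rewrite addr_ge0 // subr_ge0.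
- move=> hs vhs sz /= act; rewrite /U sz subnn expr0 mulr1 /phi act.
  have r0 : (0 < size (cur hs) + (K - bounces hs))%N.
    by rewrite addn_gt0 subn_gt0; case/andP: act => ->; rewrite orbT.
  rewrite -(prednK r0) exprS.
  have : a * a ^+ (size (cur hs) + (K - bounces hs)).-1 <= a.
    by rewrite ler_piMr // ltW.
  have a1'' : a * 2 <= 1 by rewrite mulrC a2 gerBl ltW.
  move: (a * _) => A Aa; rewrite mulrBr mulr1 lerBrDr -lerBrDl.
  apply: (@le_trans _ _ (2 * a)); first by rewrite ler_pM2l.
  by rewrite mulrC (le_trans a1'') //; lra.
- rewrite /U subSS subn0 -[leRHS]mulr1; apply: ler_wpM2l => //.
  by rewrite mulr_ge0 // exprn_ge0 // ltW.
Qed.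

(** The martingale [cond_extinct] is 0 once depth [L] is reached, and it starts
    from [extinct L K]. *)
Lemma reached_bound L K n : (0 < L)%N -> (0 < K)%N ->
  pr P [set w | (bounces (hist X n w) < K)%N && ~~ low L (hist X n w)] <=
  1 - extinct b M q L K.
Proof.
move=> L0 K0; pose U hs : R := if (K <= bounces hs)%N then 0
  else 1 - cond_extinct M q L (moves hs) (Defs.root b) K.
apply: le_trans (supermartingale_bound b_gt0 q_gt0 q_lt1 hX (n := n)
  (B := [set hs | (bounces hs < K)%N && ~~ low L hs]) (U := U) _ _ _) _.
- by move=> hs _; rewrite /U; case: ifP => // _; rewrite subr_ge0; case/andP: (cond_unit L hs K).
- move=> hs vhs _; have hs0 := valid_neq0 vhs; rewrite {2}/U.
  case: leqP => [Kf|fK].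
    rewrite -[leRHS](step_mean_const b_gt0 (bias M q hs)).
    apply: (step_mean_le q_gt0 q_lt1) => o _.
    by rewrite /U bounces_cons // (leq_trans Kf) // leq_addr.
  have U1 hs' : U hs' <= 1 - cond_extinct M q L (moves hs') (Defs.root b) K.
    by rewrite /U; case: ifP => // _; rewrite subr_ge0; case/andP: (cond_unit L hs' K).
  have [lowhs|high] := boolP (low L hs); last first.
    rewrite (walk_reached b_gt0 q_gt0 q_lt1 K vhs L0 high) subr0.
    rewrite -[leRHS](step_mean_const b_gt0 (bias M q hs)).
    apply: (step_mean_le q_gt0 q_lt1) => o _; apply: le_trans (U1 _) _.
    by rewrite gerBl; case/andP: (cond_unit L (move (cur hs) o :: hs) K).
  rewrite -(walk_step b_gt0 q_gt0 q_lt1 vhs lowhs fK).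
  rewrite -[X in X - _](step_mean_const b_gt0 (bias M q hs)).
  apply: le_trans (step_mean_le q_gt0 q_lt1 (fun o _ => U1 _)) _.
  by apply: eq_ler; rewrite /step_mean sumrB; ring.
- move=> hs vhs _ /= /andP[fK high]; rewrite /U leqNgt fK /=.
  by rewrite (walk_reached b_gt0 q_gt0 q_lt1 K vhs L0 high) subr0.
- rewrite /U leqNgt K0 /=; apply: eq_ler; congr (1 - _).
  exact: cond_extinct0.
Qed.

(** Depth [n.+1] is out of reach by time [n], so [cond_extinct] equals 1 at the
    time of the [K]-th bounce. *)
Lemma completed_bound K n : (0 < K)%N ->
  pr P [set w | (K <= bounces (hist X n w))%N] <= extinct b M q n.+1 K.
Proof.
move=> K0; pose L := n.+1; pose U hs : R := if ~~ low L hs then 0 else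
  if (K <= bounces hs)%N then 1
  else cond_extinct M q L (moves hs) (Defs.root b) K.
have U01 hs : 0 <= U hs <= 1.
  rewrite /U; case: ifP => _; first by rewrite lexx ler01.
  by case: ifP => _; rewrite ?lexx ?ler01.
apply: le_trans (supermartingale_bound b_gt0 q_gt0 q_lt1 hX (n := n)
  (B := [set hs | (K <= bounces hs)%N]) (U := U) _ _ _) _.
- by move=> hs _; case/andP: (U01 hs).
- move=> hs vhs _; have hs0 := valid_neq0 vhs; rewrite {2}/U.
  have [lowhs|high] := boolP (low L hs); last first.
    rewrite -[leRHS](step_mean_const b_gt0 (bias M q hs)).
    apply: (step_mean_le q_gt0 q_lt1) => o _.
    by rewrite /U /= (negbTE high) andbF.
  case: leqP => [Kf|fK].
    rewrite -[leRHS](step_mean_const b_gt0 (bias M q hs)).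
    by apply: (step_mean_le q_gt0 q_lt1) => o _; case/andP: (U01 (move (cur hs) o :: hs)).
  rewrite -(walk_step b_gt0 q_gt0 q_lt1 vhs lowhs fK).
  apply: (step_mean_le q_gt0 q_lt1) => o mo.
  rewrite /U; have [low'|_] := boolP (low L (move (cur hs) o :: hs)); last first.
    by case/andP: (cond_unit L (move (cur hs) o :: hs) K).
  case: leqP => [Kf'|//].
  have v' := valid_move vhs mo.
  have Kf := Kf'; rewrite bounces_cons // in Kf.
  have [cr oN] : cur hs = Defs.root b /\ o = None.
    by move: Kf; case: eqP => [->|_]; case: eqP => [->|_] //=; lia.
  have <- : bounces (move (cur hs) o :: hs) = K.
    by move: Kf; rewrite bounces_cons // cr oN !eqxx /=; lia.
  rewrite (@walk_complete _ _ _ _ L) //.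
  by rewrite /= cr oN.
- move=> hs vhs sz /= Kf; rewrite /U.
  have -> : low L hs by rewrite /L -sz; exact: valid_size vhs.
  by rewrite /= Kf.
- rewrite /U (_ : low L _ = true) // (_ : (K <= _)%N = false); last first.
    by apply/negbTE; rewrite -ltnNge.
  by apply: eq_ler; exact: (cond_extinct0 M b_gt0 q_gt0 q_lt1 L).
Qed.

End root_returns.

(** * Recurrence and transience *)
Section recurrence.
Context {d : measure_display} {T : measurableType d} {R : realType}.
Context (P : probability T R) (b M : nat) (q : R) (X : nat -> T -> vertex b).
Context (b_gt0 : (0 < b)%N) (q_gt0 : 0 < q) (q_lt1 : q < 1).
Context (hX : cookie_walk P (nseq_tuple M (0 : R)) q X).
Implicit Types (x y z : vertex b) (hs : seq (vertex b)) (o : option 'I_b).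

Lemma infinite_visits x w :
  infinite_set [set n | X n w = x] <-> visits_unbounded X x w.
Proof.
have pastS n : past (hist X n.+1 w) x = ((X n w == x) + past (hist X n w) x)%N.
  by case: n.
split=> [inf k|unb].
  elim: k => [|k [n kn]]; first by exists 0%N.
  apply: contrapT => none; apply: inf.
  apply: (sub_finite_set (B := `I_n)); last exact: finite_II.
  move=> m /= Xm; rewrite ltnNge; apply/negP => nm; apply: none.
  exists m.+1; rewrite pastS Xm eqxx add1n ltnS.
  exact: leq_trans kn (past_hist_nd X x w nm).
move=> /finite_seqP[s sE].
have last m : (\max_(i <- s) i < m)%N -> X m w != x.
  move=> sm; apply/eqP => Xm.
  have ms : m \in s by have : [set` s] m by rewrite -sE.
  by have := @leq_bigmax_seq _ s xpredT id m ms isT; rewrite /= leqNgt sm.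
pose N := (\max_(i <- s) i).+1.
have const n : past (hist X (N + n) w) x = past (hist X N w) x.
  elim: n => [|n IH]; first by rewrite addn0.
  by rewrite addnS pastS IH (negbTE (last _ _)) // /N addSn ltnS leq_addr.
have [n] := unb (past (hist X N w) x).+1.
apply/negP; rewrite -leqNgt -(const n); apply: past_hist_nd; exact: leq_addl.
Qed.

(** In this form the event is visibly measurable. *)
Lemma recurrentE :
  [set w | forall x : vertex b, infinite_set [set n | X n w = x]] =
  [set w | forall x, visits_unbounded X x w].
Proof. by apply/seteqP; split => w h x; exact/infinite_visits. Qed.

Lemma root_visits_le_bounces :
  pr P (visits_unbounded X (Defs.root b)) <=
  pr P (moves_unbounded X (Defs.root b) None).
Proof.
apply: (visits_le_moves b_gt0 q_gt0 q_lt1 hX (e := 1 - q)).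
  by rewrite subr_gt0 q_lt1 gerBl ltW.
move=> hs _ _; rewrite /= lerD2l lerN2 /bias; case: ifP => _ //; exact: ltW.
Qed.

Lemma visits_le_son_visits x i :
  pr P (visits_unbounded X x) <= pr P (visits_unbounded X (son x i)).
Proof.
apply: (@le_trans _ _ (pr P (moves_unbounded X x (Some i)))).
  apply: (visits_le_moves b_gt0 q_gt0 q_lt1 hX (e := q / b%:R)).
    rewrite divr_gt0 ?ltr0n // ler_pdivrMr ?ltr0n // mul1r.
    by rewrite (le_trans (ltW q_lt1)) // ler1n.
  by move=> hs cx late; rewrite /= /bias cx ltnNge late.
apply: pr_le.
- exact: (measurable_unbounded hX (fun hs => moves hs x (Some i))).
- exact: (measurable_unbounded hX (past^~ (son x i))).
move=> w h k; have [n kn] := h k.+1; exists n.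
exact: leq_trans kn (moves_le_past_target _ _ _).
Qed.

Lemma recurrent_of_bounces :
  pr P (moves_unbounded X (Defs.root b) None) = 1 -> recurrent P X.
Proof.
move=> h1.
have mV x : measurable (visits_unbounded X x) := measurable_unbounded hX (past^~ x).
have V1 x : pr P (visits_unbounded X x) = 1.
  apply/le_anti; rewrite pr_le1 //=; elim: x => [|i x IH].
    rewrite -h1; apply: pr_le => //.
      exact: (measurable_unbounded hX (fun hs => moves hs _ None)).
    move=> w h k; have [n kn] := h k; exists n.
    exact: leq_trans kn (moves_le_past _ _ _).
  exact: le_trans IH (visits_le_son_visits x i).
pose F n : set T := if (unpickle n : option (seq 'I_b)) is Some x
  then ~` visits_unbounded X x else set0.
have mF n : measurable (F n).
  by rewrite /F; case: unpickle => // x; exact: measurableC.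
have F0 n : P.-negligible (F n).
  suff : P (F n) = 0%E by move/negligibleP; apply.
  rewrite -(prE P (mF n)) /F; case: unpickle => [x|]; last by rewrite pr_set0.
  by rewrite pr_setC // V1 subrr.
have mU : measurable (\bigcup_n F n) by exact: bigcupT_measurable.
rewrite /recurrent recurrentE.
have -> : [set w | forall x, visits_unbounded X x w] = ~` \bigcup_n F n.
  apply/seteqP; split => w /=.
    by move=> h [n _]; rewrite /F; case: unpickle => // x; apply.
  move=> h x; apply: contrapT => nx; apply: h.
  by exists (pickle (x : seq 'I_b)) => //; rewrite /F pickleK.
rewrite probability_setC //.
have -> : P (\bigcup_n F n) = 0%E by apply/negligibleP => //; exact: negligible_bigcup.
by rewrite sube0.
Qed.

Lemma bounces_of_recurrent :
  recurrent P X -> pr P (moves_unbounded X (Defs.root b) None) = 1.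
Proof.
rewrite /recurrent recurrentE => rec.
have mJ := measurable_unbounded hX (fun hs => moves hs (Defs.root b) None).
have mV x : measurable (visits_unbounded X x) := measurable_unbounded hX (past^~ x).
apply/le_anti; rewrite pr_le1 //=.
apply: le_trans root_visits_le_bounces.
have mA : measurable [set w | forall x, visits_unbounded X x w].
  have -> : [set w | forall x, visits_unbounded X x w] =
      ~` \bigcup_(x in [set: seq 'I_b]) ~` visits_unbounded X x.
    rewrite setC_bigcup; apply/seteqP; split => w /= h x; rewrite ?setCK //.
    by have := h x I; rewrite setCK.
  apply: measurableC; apply: countable_bigcupT_measurable; first exact: countableP.
  by move=> x; exact: measurableC.
rewrite (_ : 1 = pr P [set w | forall x, visits_unbounded X x w]).
  by apply: pr_le => // w /(_ (Defs.root b)).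
by rewrite /pr rec.
Qed.

(** Before time [n], the walk has bounced [K] times, or reached depth [L], or
    stayed confined. The second event is unlikely by [extinct_to1] when [L] is
    large, and the third one when [n] is large. *)
Lemma bounces_subcritical : b%:R * odds b q ^+ M.+1 <= 1 ->
  pr P (moves_unbounded X (Defs.root b) None) = 1.
Proof.
move=> le1; pose f hs := moves hs (Defs.root b) None.
have mJ := measurable_unbounded hX f.
have mf (A : set (seq (vertex b))) n : measurable [set w | A (hist X n w)].
  exact: measurable_hist hX n A.
pose few K := \bigcap_n [set w | (f (hist X n w) < K.+1)%N].
have mfew K : measurable (few K).
  apply: bigcapT_measurable => n; exact: (mf [set hs | (f hs < K.+1)%N] n).
suff : pr P (~` moves_unbounded X (Defs.root b) None) <= 0.
  rewrite pr_setC // => h; apply/le_anti; rewrite pr_le1 //=; lra.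
apply: (@le_trans _ _ (pr P (\bigcup_K few K))).
  apply: pr_le; [exact: measurableC|exact: bigcupT_measurable|].
  move=> w /existsNP[K hK]; exists K => // n _ /=.
  by rewrite ltnNge; apply/negP => h; apply: hK; exists n; exact: ltnW.
apply: pr_bigcup_le => // [m n mn|K].
  by apply/subsetPset => w h i _ /=; apply: leq_trans (h i I) _.
apply/ler_addgt0Pr => e e0; rewrite add0r.
have e2 : 0 < e / 2 by rewrite divr_gt0.
have [L hL] := extinct_to1 b_gt0 q_gt0 q_lt1 le1 K.+1 e2.
set rho := 1 - ((1 - q) / 2) ^+ (L.+1 + K.+1).
have rho01 : 0 <= rho < 1.
  have a0 : 0 < (1 - q) / 2 by rewrite divr_gt0 // subr_gt0.
  have a1 : (1 - q) / 2 <= 1 by have := q_gt0; lra.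
  by rewrite /rho subr_ge0 exprn_ile1 ?(ltW a0) //= gtrBl exprn_gt0.
have [n hn] := expr_small (ltr0n R 2) rho01 e2.
have mA := mf [set hs | (f hs < K.+1)%N] n.
apply: (@le_trans _ _ (pr P [set w | (f (hist X n w) < K.+1)%N])).
  by apply: pr_le => // w /(_ n I).
pose low hs := all (fun y : vertex b => (size y < L.+1)%N) hs.
have mB := mf [set hs | low hs] n.
rewrite (pr_split P mA mB).
have -> : [set w | (f (hist X n w) < K.+1)%N] `\` [set w | low (hist X n w)] =
    [set w | (f (hist X n w) < K.+1)%N && ~~ low (hist X n w)].
  apply/seteqP; split => w /=.
    by move=> [fK /negP nl]; apply/andP.
  by move=> /andP[fK /negP nl].
have -> : [set w | (f (hist X n w) < K.+1)%N] `&` [set w | low (hist X n w)] =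
    [set w | (f (hist X n w) < K.+1)%N && low (hist X n w)].
  apply/seteqP; split => w /=.
    by move=> [fK lw]; apply/andP.
  by move=> /andP[fK lw].
have := reached_bound b_gt0 q_gt0 q_lt1 hX n (ltn0Sn L) (ltn0Sn K).
have := confined_bound b_gt0 q_gt0 q_lt1 hX L.+1 n (ltn0Sn K).
move: hn hL; rewrite -/rho -/low -/f => hn hL h1 h2; lra.
Qed.

Lemma bounces_supercritical : (1 < b)%N -> 1 < b%:R * odds b q ^+ M.+1 ->
  pr P (moves_unbounded X (Defs.root b) None) < 1.
Proof.
move=> b_gt1 gt1.
have [K [u u1 hu]] := extinct_lt1 b_gt1 q_gt0 q_lt1 (erefl _) gt1.
have K0 : (0 < K)%N.
  rewrite lt0n; apply/eqP => K0; have := hu 0%N; rewrite K0 /= => h.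
  by have := le_lt_trans h u1; rewrite ltxx.
apply: le_lt_trans u1.
pose A n := [set w | (K <= moves (hist X n w) (Defs.root b) None)%N].
have mA n : measurable (A n).
  exact: (measurable_hist hX n [set hs | (K <= moves hs (Defs.root b) None)%N]).
apply: (@le_trans _ _ (pr P (\bigcup_n A n))).
  apply: pr_le; [|exact: bigcupT_measurable|by move=> w /(_ K)[n Kn]; exists n].
  exact: (measurable_unbounded hX (fun hs => moves hs (Defs.root b) None)).
apply: pr_bigcup_le => // [m n mn|n].
  apply/subsetPset => w /= h; exact: leq_trans h (moves_hist_nd X _ _ w mn).
exact: le_trans (completed_bound b_gt0 q_gt0 q_lt1 hX n K0) (hu _).
Qed.

End recurrence.

Theorem corollary1p7 (R : realType) (b : nat) (hb : (2 <= b)%N)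
  (M : nat) (hM : (1 <= M)%N) (q : R) (hq : 0 < q < 1)
  (d : measure_display) (T : measurableType d) (P : probability T R)
  (X : nat -> T -> vertex b)
  (hX : cookie_walk P (nseq_tuple M (0 : R)) q X) :
  recurrent P X <-> lambda_dig b M q <= 1 / b%:R.
Proof.
have /andP[q0 q1] := hq; have b0 : (0 < b)%N by exact: ltnW.
have -> : (lambda_dig b M q <= 1 / b%:R) = (b%:R * odds b q ^+ M.+1 <= 1).
  by rewrite ler_pdivlMr ?ltr0n // mulrC.
split=> [rec|le1]; last first.
  apply: (recurrent_of_bounces b0 q0 q1 hX); exact: (bounces_subcritical b0 q0 q1 hX le1).
rewrite leNgt; apply/negP => /(bounces_supercritical b0 q0 q1 hX hb).
by rewrite (bounces_of_recurrent b0 q0 q1 hX rec) ltxx.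
Qed.
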